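(* Let $K\in\mathbb{R}$ and let $N\in(1,\infty)$ be an integer. Let $(X,d,m)$ be a nontrivial $RCD^*(K,N)$ space with $\mathrm{supp}\,m=X$ that satisfies the generalized Bishop inequality $BI(K,N)$. Then $$0<\liminf_{r\to0}\frac{m(B_r(x))}{r^N}\le\limsup_{r\to0}\frac{m(B_r(x))}{r^N}<\infty$$ holds for every $x\in X$. In particular it holds for every $x\in\mathcal{R}_N$.
   Context: A metric measure space $(X,d,m)$ is a complete separable metric space $(X,d)$ with a locally finite $\sigma$-compact positive Borel measure $m$ on $X$. $B_r(x)$ is the ball of radius $r$ centered at $x$; $B^{d_r}_s(x)$ is the ball of radius $s$ for the distance $d_r$ below. $(X,d,m)$ is nontrivial if $\mathrm{Diam}(X,d)>0$ and $m(X)\in(0,\infty]$. Two metric measure spaces $(X,d,m)$, $(Y,r,\nu)$ are isomorphic if there is an isometry $f:\mathrm{supp}\,m\to\mathrm{supp}\,\nu$ with $f_*m=\nu$. Infinitesimal Hilbertianity: for Lipschitz $f$ on $X$, $|\nabla f|(x)=\limsup_{y\to x}|f(x)-f(y)|/d(x,y)$ if $x$ is not isolated, and $\infty$ otherwise. For $f\in L^2(X,m)$ the Cheeger energy is $\mathsf{Ch}(f)=\frac12\inf\{\liminf_n\int_X|\nabla f_n|^2dm\}$, the infimum over sequences of Lipschitz functions $f_n\to f$ in $L^2(X,m)$. $W^{1,2}(X,d,m)=\{f\in L^2:\mathsf{Ch}(f)<\infty\}$ with norm $\|f\|_{1,2}^2=\|f\|_2^2+2\mathsf{Ch}(f)$.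 $(X,d,m)$ is infinitesimally Hilbertian if $W^{1,2}$ is a Hilbert space. $RCD^*(K,N)$: for $K\in\mathbb{R}$, $N\in(1,\infty)$, $t\in[0,1]$ let $\sigma^{(t)}_{K,N}(\theta)=\infty$ if $K\theta^2\ge N\pi^2$, $\frac{\sin(t\theta\sqrt{K/N})}{\sin(\theta\sqrt{K/N})}$ if $0<K\theta^2<N\pi^2$, $t$ if $K\theta^2=0$, $\frac{\sinh(t\theta\sqrt{-K/N})}{\sinh(\theta\sqrt{-K/N})}$ if $K\theta^2<0$. A function $f:Y\to\mathbb{R}\cup\{\pm\infty\}$ on a geodesic metric space $(Y,d_Y)$ is $(K,N)$-convex if any $y_0,y_1\in Y$ are joined by a (constant speed) geodesic $(y_t)_{t\in[0,1]}$ with $e^{-f(y_t)/N}\ge\sigma^{(1-t)}_{K,N}(d_Y(y_0,y_1))e^{-f(y_0)/N}+\sigma^{(t)}_{K,N}(d_Y(y_0,y_1))e^{-f(y_1)/N}$ for all $t\in[0,1]$. The relative entropy is $\mathrm{Ent}_m(\mu)=\int_{\{\rho>0\}}\rho\log\rho\,dm$ if $\mu=\rho m\ll m$ and $(\rho\log\rho)_+$ is integrable, and $\infty$ otherwise. A geodesic metric measure space $(X,d,m)$ satisfies $CD^e(K,N)$ if $\mathrm{Ent}_m$ is $(K,N)$-convex on the $L^2$-Wasserstein space $(\mathcal{P}_2(X),W_2)$; it is an $RCD^*(K,N)$ space if moreover it is infinitesimally Hilbertian. Tangent cones: a pointed metric measure space $(X,d,m,x_0)$ is normalized if $\int_{B_1(x_0)}(1-d(x_0,\cdot))\,dm=1$.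 For $x\in\mathrm{supp}\,m$, $r\in(0,1)$ let $d_r=d/r$ and $m^x_r=\left(\int_{B_r(x)}(1-d_r(x,\cdot))\,dm\right)^{-1}m$. $\mathrm{Tan}(X,x)$ is the set of all pointed measured Gromov–Hausdorff limits (tangent cones at $x$) $(Y,d_Y,m_Y,y)$ of $(X,d_{r_n},m^x_{r_n},x)$ for non-increasing sequences $r_n\to0$. $\mathcal{R}_k$ is the set of $x\in\mathrm{supp}\,m$ with $\mathrm{Tan}(X,x)=\{(\mathbb{R}^k,d_E,\underline{\mathcal{L}}^k,0)\}$ (up to isomorphism), where $d_E$ is the Euclidean distance and $\underline{\mathcal{L}}^k$ is the multiple of Lebesgue measure normalized at $0$, i.e. such that $\int_{B_1(0)}(1-d_E(0,\cdot))\,d\underline{\mathcal{L}}^k=1$. Generalized Bishop inequality: for $K'\in\mathbb{R}$, $N'\in\mathbb{N}$, let $\underline{V}_{K',N'}(s)$ be the volume of a ball of radius $s$ about a point $o$ in the (simply connected) $N'$-dimensional space form of constant curvature $K'$, with respect to the multiple $\mathrm{v}$ of the Riemannian volume normalized at $o$, i.e. such that $\int_{B_1(o)}(1-d(o,\cdot))\,d\mathrm{v}=1$, where $d$ is the Riemannian distance of the space form. $(X,d,m)$ satisfies $BI(K',N')$ if for any $\epsilon>0$ and $x\in X$ there is $r_{\epsilon,x}>0$ such that $m^x_r(B^{d_r}_s(x))\le(1+\epsilon)\underline{V}_{r^2K',N'}(s)$ for all $r\in(0,r_{\epsilon,x})$ and all $s\in(0,\min\{\mathrm{Diam}\,X,1\})$.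 *)

(* Defs.v *)
From HB Require Import structures.
From mathcomp Require Import all_boot all_order all_algebra.
From mathcomp Require Import all_classical all_reals all_analysis.
From mathcomp Require Import ring.

Set Implicit Arguments.
Unset Strict Implicit.
Unset Printing Implicit Defensive.

Import Order.TTheory GRing.Theory Num.Theory.
Import numFieldNormedType.Exports.

Local Open Scope classical_set_scope.
Local Open Scope ring_scope.

#[short(type="pmetricType")]
HB.structure Definition PointedMetric (R : numDomainType) :=
  {T of Metric R T & isPointed T}.

Notation borel X := (g_sigma_algebraType (@open X)).

Section metric_measure_spaces.
Context {R : realType}.
Implicit Types X Y : pmetricType R.

Definition supp X (m : {measure set (borel X) -> \bar R}) : set X :=
  [set x | forall r : R, 0 < r -> (0 < m (ball x r))%E].

Definition complete_metric X :=
  forall F : set_system X, ProperFilter F -> cauchy F -> cvg F.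

Definition separable X := exists A : set X, countable A /\ dense A.

Definition locally_finite X (m : {measure set (borel X) -> \bar R}) :=
  forall x : X, exists2 r : R, 0 < r & (m (ball x r) < +oo)%E.

(* The measure is concentrated on a countable union of compact sets. *)
Definition sigma_compact X (m : {measure set (borel X) -> \bar R}) :=
  exists2 C : nat -> set X, forall n, compact (C n) & m (~` \bigcup_n C n) = 0%E.

Definition metric_measure_space X (m : {measure set (borel X) -> \bar R}) :=
  [/\ complete_metric X, separable X, locally_finite m & sigma_compact m].

Definition diam X : \bar R :=
  ereal_sup [set (mdist p.1 p.2)%:E | p in [set: X * X]].

Definition nontrivial X (m : {measure set (borel X) -> \bar R}) :=
  (0 < diam X)%E /\ (0 < m [set: X])%E.

Definition geodesic (T : Type) (dist : T -> T -> R) (g : R -> T) :=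
  forall s t, 0 <= s <= 1 -> 0 <= t <= 1 ->
    dist (g s) (g t) = `|s - t| * dist (g 0) (g 1).

Definition geodesic_space X :=
  forall x y : X, exists g : R -> X, [/\ g 0 = x, g 1 = y & geodesic mdist g].

(* Functions on X stand for their m-a.e. classes below. *)

Definition lipschitz_fun X (f : X -> R) :=
  exists L : R, forall x y, `|f x - f y| <= L * mdist x y.

Definition slope X (f : X -> R) (x : X) : \bar R :=
  if `[< isolated [set: X] x >] then +oo%E
  else limf_esup (fun y => (`|f x - f y| / mdist x y)%:E) x^'.

Definition L2norm X (m : {measure set (borel X) -> \bar R}) (f : X -> R)
    : \bar R :=
  'N[m]_2%:E[(fun x : borel X => (f x)%:E)].

Definition cheeger X (m : {measure set (borel X) -> \bar R}) (f : X -> R)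
    : \bar R :=
  ((2^-1)%:E * ereal_inf
    [set limn_einf (fun n => \int[m]_x (slope (u n) x ^+ 2)) | u in
      [set u : nat -> X -> R | (forall n, lipschitz_fun (u n)) /\
        L2norm m (fun x => (u n x - f x)%R) @[n --> \oo] --> 0%E]])%E.

Definition W12 X (m : {measure set (borel X) -> \bar R}) : set (X -> R) :=
  [set f | (f : borel X -> R) \in Lfun m 2%:E /\ (cheeger m f < +oo)%E].

Definition W12norm X (m : {measure set (borel X) -> \bar R}) (f : X -> R) : R :=
  Num.sqrt (fine (L2norm m f ^+ 2 + 2%:E * cheeger m f)%E).

(* The norm of W12 comes from an inner product B, and W12 is complete. *)
Definition infinitesimally_hilbertian X
    (m : {measure set (borel X) -> \bar R}) :=
  [/\ forall (a : R) f g, W12 m f -> W12 m g -> W12 m (a *: f + g),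
      exists B : (X -> R) -> (X -> R) -> R,
        [/\ forall f g, W12 m f -> W12 m g -> B f g = B g f,
            forall (a : R) f g h, W12 m f -> W12 m g -> W12 m h ->
              B (a *: f + g) h = a * B f h + B g h
          & forall f, W12 m f -> B f f = W12norm m f ^+ 2]
    & forall u : nat -> X -> R, (forall n, W12 m (u n)) ->
        (forall e : R, 0 < e -> exists n0 : nat, forall i j,
          (n0 <= i)%N -> (n0 <= j)%N -> W12norm m (u i - u j) < e) ->
        exists2 f, W12 m f & W12norm m (u n - f) @[n --> \oo] --> 0].

(* For a separable X the product sigma-algebra on borel X * borel X is the
   Borel sigma-algebra of the product space. *)
Definition coupling X (mu nu : probability (borel X) R)
    : set (probability (borel X * borel X)%type R) :=
  [set p : probability (borel X * borel X)%type R |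
           (forall A : set (borel X), measurable A ->
              p (A `*` setT) = mu A) /\
           (forall A : set (borel X), measurable A ->
              p (setT `*` A) = nu A)].

Definition P2 X : set (probability (borel X) R) :=
  [set mu : probability (borel X) R |
    exists x0 : X, (\int[mu]_x (mdist x0 (x : X) ^+ 2)%:E < +oo)%E].

Definition W2 X (mu nu : probability (borel X) R) : R :=
  Num.sqrt (fine (ereal_inf
    [set \int[p]_z (mdist (z.1 : X) (z.2 : X) ^+ 2)%:E | p in coupling mu nu]%E)).

(* The set is empty, or a singleton since the density rho is unique a.e.;
   in the former case the infimum is +oo. *)
Definition entropy X (m : {measure set (borel X) -> \bar R})
    (mu : probability (borel X) R) : \bar R :=
  ereal_inf
    [set (\int[m]_(x in [set x | (0 < rho x)%R]) (rho x * ln (rho x))%:E)%E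
      | rho in [set rho : borel X -> R |
        [/\ measurable_fun setT rho, forall x, 0 <= rho x,
            forall A, measurable A -> mu A = (\int[m]_(x in A) (rho x)%:E)%E
          & (\int[m]_x (Num.max (rho x * ln (rho x)) 0)%:E < +oo)%E]]].

Definition sinh (x : R) : R := (expR x - expR (- x)) / 2.

Definition sigma (K N t theta : R) : \bar R :=
  if N * pi ^+ 2 <= K * theta ^+ 2 then +oo%E
  else if 0 < K * theta ^+ 2 then
    (sin (t * theta * Num.sqrt (K / N)) / sin (theta * Num.sqrt (K / N)))%:E
  else if K * theta ^+ 2 == 0 then t%:E
  else (sinh (t * theta * Num.sqrt (- K / N)) /
        sinh (theta * Num.sqrt (- K / N)))%:E.

(* Products follow the convention 0 * +oo = 0. *)
Definition KN_convex (T : Type) (D : set T) (dist : T -> T -> R) (K N : R)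
    (f : T -> \bar R) :=
  forall y0 y1, D y0 -> D y1 -> exists y : R -> T,
    [/\ y 0 = y0, y 1 = y1, forall t, 0 <= t <= 1 -> D (y t),
        geodesic dist y
      & forall t, 0 <= t <= 1 ->
          (sigma K N (1 - t) (dist y0 y1) * expeR (- (f y0 * (N^-1)%:E)) +
           sigma K N t (dist y0 y1) * expeR (- (f y1 * (N^-1)%:E))
             <= expeR (- (f (y t) * (N^-1)%:E)))%E].

Definition CDe (K N : R) X (m : {measure set (borel X) -> \bar R}) :=
  geodesic_space X /\ KN_convex (@P2 X) (@W2 X) K N (entropy m).

Definition RCDstar (K N : R) X (m : {measure set (borel X) -> \bar R}) :=
  CDe K N m /\ infinitesimally_hilbertian m.

Definition cone_mass d (T : measurableType d) (m : {measure set T -> \bar R})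
    (dist : T -> R) : \bar R :=
  \int[m]_(y in [set y | (dist y < 1)%R]) (1 - dist y)%:E.

Lemma inv_cone_mass_ge0 d (T : measurableType d)
    (m : {measure set T -> \bar R}) (dist : T -> R) :
  0 <= (fine (cone_mass m dist))^-1.
Proof.
rewrite invr_ge0 fine_ge0//; apply: integral_ge0 => y /= y1.
by rewrite lee_fin subr_ge0 ltW.
Qed.

(* The factor is 0 when the mass is infinite. *)
Definition normalize_at d (T : measurableType d) (m : {measure set T -> \bar R})
    (dist : T -> R) : {measure set T -> \bar R} :=
  mscale (NngNum (inv_cone_mass_ge0 m dist)) m.

Definition rescaled_measure X (m : {measure set (borel X) -> \bar R})
    (x : X) (r : R) : {measure set (borel X) -> \bar R} :=
  normalize_at m (fun y => mdist x y / r).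

(* Limit of (X, d n, m n, x), where the distances d n all induce the topology
   of X. *)
Definition pmGH_cvg X (d : nat -> X -> X -> R)
    (m : nat -> {measure set (borel X) -> \bar R}) (x : X)
    Y (mY : {measure set (borel Y) -> \bar R}) (y : Y) :=
  exists (f : nat -> X -> Y) (eps rad : nat -> R),
    [/\ (forall n, 0 < eps n) /\ eps @ \oo --> 0, rad @ \oo --> +oo,
        forall n,
          [/\ measurable_fun setT (f n : borel X -> borel Y),
              f n x = y,
              forall u v, d n x u < rad n -> d n x v < rad n ->
                `|d n u v - mdist (f n u) (f n v)| <= eps n
            & forall z, mdist y z < rad n - eps n ->
                exists2 u, d n x u < rad n & mdist (f n u) z < eps n]
      & forall phi : Y -> R, continuous phi ->
          (exists M : R, forall z, `|phi z| <= M) ->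
          (exists r : R, forall z, r <= mdist y z -> phi z = 0) ->
          (\int[m n]_(u in [set u | (d n x u < rad n)%R]) (phi (f n u))%:E)%E
            @[n --> \oo] --> (\int[mY]_z (phi z)%:E)%E].

Definition tangent_cone X (m : {measure set (borel X) -> \bar R}) (x : X)
    Y (mY : {measure set (borel Y) -> \bar R}) (y : Y) :=
  metric_measure_space mY /\
  exists r : nat -> R,
    [/\ forall n, 0 < r n < 1, {homo r : i j / (i <= j)%N >-> j <= i},
        r @ \oo --> 0
      & pmGH_cvg (fun n u v => mdist u v / r n)
          (fun n => rescaled_measure m x (r n)) x mY y].

Definition pointed_isomorphic X (m : {measure set (borel X) -> \bar R}) (x : X)
    Y (mY : {measure set (borel Y) -> \bar R}) (y : Y) :=
  exists f : X -> Y,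
    [/\ supp m x /\ f x = y,
        forall u v, supp m u -> supp m v -> mdist (f u) (f v) = mdist u v,
        f @` supp m = supp mY
      & forall B : set (borel Y), measurable B ->
          mY B = m (supp m `&` f @^-1` B)].

End metric_measure_spaces.

Section pushforward_measure.
Context d1 d2 (T1 : measurableType d1) (T2 : measurableType d2) (R : realType).
Variables (m : {measure set T1 -> \bar R}) (f : T1 -> T2).
Hypothesis mf : measurable_fun [set: T1] f.

Definition pushforward_measure of measurable_fun [set: T1] f := pushforward m f.
HB.instance Definition _ := Measure.copy (pushforward_measure mf)
 (measure_function_pushforward__canonical__measure_function_Measure m mf).
End pushforward_measure.

Section lebesgue_tuple.
Context {R : realType}.

Lemma measurable_snoc n : measurable_fun setT
  (fun p : n.-tuple R * measurableTypeR R => [the n.+1.-tuple R of (p.2 : R) :: p.1]).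
Proof.
apply: measurable_cons; [exact: measurable_snd|exact: measurable_fst].
Qed.

Fixpoint lebesgue_tuple (n : nat) : {measure set (n.-tuple R) -> \bar R} :=
  match n with
  | 0 => \d_[tuple]
  | k.+1 => pushforward_measure (lebesgue_tuple k \x @lebesgue_measure R)%E
      (@measurable_snoc k)
  end.
End lebesgue_tuple.

Definition euclidean (R : realType) (n : nat) : Type := n.-tuple R.
HB.instance Definition _ R n := Choice.on (euclidean R n).
HB.instance Definition _ R n := Pointed.on (euclidean R n).

Section euclidean.
Context {R : realType} {n : nat}.
Implicit Types x y z : euclidean R n.

Definition edist x y := Num.sqrt (\sum_(i < n) (tnth x i - tnth y i) ^+ 2).

Lemma edistxx x : edist x x = 0.
Proof. by rewrite /edist big1 ?sqrtr0// => i _; rewrite subrr expr0n. Qed.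

Lemma edist_sym x y : edist x y = edist y x.
Proof. by congr Num.sqrt; apply: eq_bigr => i _; rewrite -sqrrN opprB. Qed.

Lemma edist_eq0 x y : edist x y = 0 -> x = y.
Proof.
move/eqP; rewrite sqrtr_eq0 => le0; apply: eq_from_tnth => i.
apply/eqP; rewrite -subr_eq0 -sqrf_eq0 eq_le sqr_ge0 andbT.
apply: le_trans le0; rewrite (bigD1 i)//= lerDl.
by apply: sumr_ge0 => j _; exact: sqr_ge0.
Qed.


Lemma sum_mul_le (a b : 'I_n -> R) :
  \sum_i a i * b i <=
    Num.sqrt (\sum_i a i ^+ 2) * Num.sqrt (\sum_i b i ^+ 2).
Proof.
have ge0 (c : 'I_n -> R) : 0 <= \sum_i c i ^+ 2.
  by apply: sumr_ge0 => i _; exact: sqr_ge0.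
have eq0 (c : 'I_n -> R) : Num.sqrt (\sum_i c i ^+ 2) = 0 -> forall i, c i = 0.
  move/eqP; rewrite sqrtr_eq0 => le0 i; apply/eqP.
  rewrite -sqrf_eq0 eq_le sqr_ge0 andbT; apply: le_trans le0.
  by rewrite (bigD1 i)//= lerDl; apply: sumr_ge0 => j _; exact: sqr_ge0.
set p := Num.sqrt _; set q := Num.sqrt _.
have [p0|p_neq0] := eqVneq p 0.
  by rewrite p0 mul0r big1// => i _; rewrite (eq0 a)// mul0r.
have [q0|q_neq0] := eqVneq q 0.
  by rewrite q0 mulr0 big1// => i _; rewrite (eq0 b)// mulr0.
have p_gt0 : 0 < p by rewrite lt_def p_neq0 sqrtr_ge0.
have q_gt0 : 0 < q by rewrite lt_def q_neq0 sqrtr_ge0.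
have -> : p * q = \sum_i (q / p * a i ^+ 2 + p / q * b i ^+ 2) / 2.
  rewrite -mulr_suml big_split/= -!mulr_sumr.
  rewrite -(sqr_sqrtr (ge0 a)) -(sqr_sqrtr (ge0 b)) -/p -/q.
  by field; apply/andP.
apply: ler_sum => i _; rewrite -subr_ge0.
have -> : (q / p * a i ^+ 2 + p / q * b i ^+ 2) / 2 - a i * b i =
    (q * a i - p * b i) ^+ 2 / (2 * p * q).
  by field; apply/andP.
by rewrite divr_ge0 ?sqr_ge0// !mulr_ge0// ltW.
Qed.

Lemma edist_triangle y x z : edist x z <= edist x y + edist y z.
Proof.
have ge0 : 0 <= edist x y + edist y z by rewrite addr_ge0 ?sqrtr_ge0.
rewrite -(ger0_norm ge0) -sqrtr_sqr; apply: ler_wsqrtr.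
have sge0 (c : 'I_n -> R) : 0 <= \sum_i c i ^+ 2.
  by apply: sumr_ge0 => i _; exact: sqr_ge0.
have := sum_mul_le (fun i => tnth x i - tnth y i) (fun i => tnth y i - tnth z i).
rewrite -/(edist x y) -/(edist y z) => CS.
rewrite sqrrD /edist !sqr_sqrtr// -/(edist x y) -/(edist y z).
have -> : \sum_i (tnth x i - tnth z i) ^+ 2 =
    \sum_i (tnth x i - tnth y i) ^+ 2 +
    (\sum_i (tnth x i - tnth y i) * (tnth y i - tnth z i)) *+ 2 +
    \sum_i (tnth y i - tnth z i) ^+ 2.
  by rewrite -sumrMnl -!big_split/=; apply: eq_bigr => i _; ring.
by rewrite lerD2r lerD2l lerMn2r CS.
Qed.

HB.instance Definition _ := isMetric.Build R (euclidean R n)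
  edistxx edist_eq0 edist_sym edist_triangle.

Lemma measurable_euclidean :
  measurable_fun setT (id : n.-tuple R -> borel (euclidean R n)).
Proof.
apply: (@measurability _ _ (n.-tuple R) (borel (euclidean R n)) _ _ (@open _)) => //.
move=> _ [U oU <-]; rewrite setTI preimage_id.
pose box (c : n.-tuple rat * nat) : set (n.-tuple R) :=
  \bigcap_(i in [set: 'I_n])
    ((fun y => tnth y i) @^-1` ball (ratr (tnth c.1 i) : R) c.2.+1%:R^-1).
have mbox c : measurable (box c).
  apply: fin_bigcap_measurable => [|i _]; first exact: finite_finset.
  rewrite -[X in measurable X]setTI.
  by apply: measurable_tnth => //; exact: measurable_realfun.measurable_ball.
rewrite (_ : U = \bigcup_(c : n.-tuple rat * nat)
    (if `[< box c `<=` U >] then box c else set0)).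
  apply: countable_bigcupT_measurable => [|c]; first exact: countableP.
  by case: ifPn.
apply/seteqP; split=> [x Ux|x [c _]]; last first.
  by case: ifPn => // /asboolP; exact.
have /nbhs_ballP[e /= e0 xeU] : nbhs (x : euclidean R n) U by exact: open_nbhs_nbhs.
have [k kn] : exists k : nat, n.+1%:R * 2 / e < k.+1%:R.
  exists (Num.truncn (n.+1%:R * 2 / e)); exact: truncnS_gt.
have k0 : 0 < k.+1%:R^-1 :> R by rewrite invr_gt0.
have q_ i : {q : rat | `|ratr q - tnth x i| < k.+1%:R^-1}.
  apply/cid; have [|q] := @rat_in_itvoo R (tnth x i - k.+1%:R^-1) (tnth x i + k.+1%:R^-1).
    by rewrite ltrD2l gtrN.
  by rewrite in_itv/= -ltr_distl => ?; exists q.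
exists ([tuple sval (q_ i) | i < n], k) => //.
have xbox : box ([tuple sval (q_ i) | i < n], k) x.
  by move=> i _ /=; rewrite tnth_mktuple; exact: (svalP (q_ i)).
case: ifPn => // /asboolP[]; move=> y ybox; apply: xeU.
rewrite ballEmdist/= /mdist/= /edist -[ltRHS]gtr0_norm// -sqrtr_sqr ltr_sqrt ?exprn_gt0//.
apply: (@le_lt_trans _ _ (\sum_(i < n) (2 / k.+1%:R) ^+ 2)).
  apply: ler_sum => i _; rewrite -[leLHS]real_normK ?num_real//.
  rewrite ler_pXn2r ?nnegrE ?divr_ge0//.
  have := xbox i I; have := ybox i I; rewrite /= !/ball/= => yi xi.
  rewrite -(subrKA (ratr (tnth [tuple sval (q_ i) | i < n] i))).
  rewrite (le_trans (ler_normD _ _))// (mulr_natl _ 2) mulr2n lerD ?ltW//.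
  by rewrite distrC.
rewrite sumr_const card_ord.
have ne : n.+1%:R * (2 / k.+1%:R) < e.
  by move: kn; rewrite ltr_pdivrMr// mulrA ltr_pdivrMr// [_ * e]mulrC.
apply: (@le_lt_trans _ _ ((n.+1%:R * (2 / k.+1%:R)) ^+ 2)).
  rewrite [leRHS]exprMn -[leLHS]mulr_natl ler_wpM2r ?sqr_ge0//.
  by rewrite -natrX ler_nat (leq_trans (leqnSn _))// expnS leq_pmulr// expn_gt0.
by rewrite ltr_pXn2r ?nnegrE ?mulr_ge0 ?divr_ge0 ?ltW.
Qed.

End euclidean.

Section euclidean_measure.
Context {R : realType}.

Definition euclidean_origin (n : nat) : euclidean R n := [tuple 0 | _ < n].

Definition euclidean_measure (n : nat)
    : {measure set (borel (euclidean R n)) -> \bar R} :=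
  pushforward_measure (lebesgue_tuple n) measurable_euclidean.

Definition normalized_euclidean_measure (n : nat)
    : {measure set (borel (euclidean R n)) -> \bar R} :=
  normalize_at (euclidean_measure n) (mdist (euclidean_origin n)).

Definition regular_set (X : pmetricType R)
    (m : {measure set (borel X) -> \bar R}) (k : nat) : set X :=
  [set x | [/\ supp m x,
      forall (Y : pmetricType R) (mY : {measure set (borel Y) -> \bar R}) y,
        tangent_cone m x mY y ->
        pointed_isomorphic mY y
          (normalized_euclidean_measure k) (euclidean_origin k)
    & tangent_cone m x
        (normalized_euclidean_measure k) (euclidean_origin k)]].

End euclidean_measure.

(* The n-dimensional space form of curvature K, n >= 2, in Riemann's conformal
   coordinates: the metric |dx|^2 / (1 + K |x|^2 / 4)^2 on the set where
   1 + K |x|^2 / 4 > 0. For K < 0 this is the ball model of the hyperbolic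
   space, for K > 0 it is the sphere without the antipode of the origin (which
   affects neither volumes nor distances). *)
Section space_form.
Context {R : realType}.
Implicit Types (K : R) (n : nat).

Definition sf_denom K n (x : n.-tuple R) : R :=
  1 + K / 4 * \sum_(i < n) tnth x i ^+ 2.

Definition sf_domain K n : set (n.-tuple R) := [set x | 0 < sf_denom K x].

Definition sf_origin n : n.-tuple R := [tuple 0 | _ < n].

Definition sf_point n (g : 'I_n -> R -> R) (t : R) : n.-tuple R :=
  [tuple g i t | i < n].

Definition sf_curve K n (x y : n.-tuple R) : set ('I_n -> R -> R) :=
  [set g : 'I_n -> R -> R |
          [/\ forall i t, derivable (g i) t 1,
               forall i, continuous (derive1 (g i)),
               forall t, 0 <= t <= 1 -> sf_domain K (sf_point g t),
               sf_point g 0 = x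
             & sf_point g 1 = y]].

Definition sf_length K n (g : 'I_n -> R -> R) : \bar R :=
  (\int[lebesgue_measure]_(t in `[0%R, 1%R])
    (Num.sqrt (\sum_(i < n) derive1 (g i) t ^+ 2) / sf_denom K (sf_point g t))%:E)%E.

Definition sf_dist K n (x y : n.-tuple R) : R :=
  fine (ereal_inf [set sf_length K g | g in sf_curve K x y]).

Definition sf_integral K n (A : set (n.-tuple R)) (f : n.-tuple R -> R)
    : \bar R :=
  (\int[lebesgue_tuple n]_(x in sf_domain K (n := n) `&` A)
    (f x / sf_denom K x ^+ n)%:E)%E.

Definition sf_cone_mass K n : \bar R :=
  sf_integral K [set x : n.-tuple R | sf_dist K (sf_origin n) x < 1]
    (fun x => 1 - sf_dist K (sf_origin n) x).

Definition sf_ball_volume K n (s : R) : \bar R :=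
  (((fine (sf_cone_mass K n))^-1)%:E *
   sf_integral K [set x : n.-tuple R | (sf_dist K (sf_origin n) x < s)%R]
     (cst 1%R))%E.

End space_form.

Definition bishop_inequality (R : realType) (K : R) (N : nat)
    (X : pmetricType R) (m : {measure set (borel X) -> \bar R}) :=
  forall (eps : R) (x : X), 0 < eps ->
    exists2 r0 : R, 0 < r0 & forall r s : R,
      0 < r < r0 -> 0 < s -> (s%:E < Order.min (diam X) 1)%E ->
      (rescaled_measure m x r [set y | (mdist x y / r < s)%R] <=
        (1 + eps)%:E * sf_ball_volume (r ^+ 2 * K) N s)%E.

Definition ball_density (R : realType) (N : nat) (X : pmetricType R)
    (m : {measure set (borel X) -> \bar R}) (x : X) (r : R) : \bar R :=
  (m (ball x r) * ((r ^+ N)^-1)%:E)%E.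

(* Main.v *)
Require Import Defs.
From mathcomp Require Import all_boot all_order all_algebra.
From mathcomp Require Import all_classical all_reals all_analysis.
From mathcomp Require Import ring lra.

Set Implicit Arguments.
Unset Strict Implicit.
Unset Printing Implicit Defensive.

Import Order.TTheory GRing.Theory Num.Theory.
Import numFieldNormedType.Exports.

Local Open Scope classical_set_scope.
Local Open Scope ring_scope.

Import measurable_realfun.

(** The ratio of [m (ball x r)] and [r ^ N] is bounded below because of the
    curvature-dimension condition, and above because of the Bishop inequality.

    Lower bound. Transport the Dirac mass at [x] to the uniform measure on a
    fixed small ball [B] centered at [x], along a Wasserstein geodesic given by
    the convexity of the entropy. At time [t] the interpolant is concentrated on
    the ball whose radius is [t] times that of [B]
    ([W2_interpolant_concentrated]): for almost optimal couplings, almost all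
    the mass moves almost along geodesics of [X] starting at [x]. Among the
    probability measures carried by a set the uniform one has the least entropy
    ([entropy_ge]), so the convexity inequality becomes
    [m (t B) ^ (1/N) >= sigma_t m (B) ^ (1/N)] ([CDe_ball_growth]). Since the
    distortion coefficient [sigma_t] is at least a multiple of [t]
    ([sigma_ge_linear]), [m (t B)] is at least a multiple of [t ^ N].

    Upper bound. Fix one scale [r] at which the Bishop inequality holds with
    [eps = 1]. For [s] tending to [0] it bounds [m (ball x (r s))] by a constant
    times the volume of the ball of radius [s] in the space form of curvature
    [r ^ 2 K]. That volume is at most a multiple of [s ^ N]
    ([sf_ball_volume_le]): a curve from the origin of conformal length less than
    [s] ends at a Euclidean distance of order [s] ([sf_length_ln_growth]), where
    the Riemannian metric is comparable with the Euclidean one. *)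

(** * The distance of a separable metric space is measurable *)

Section metric_measurability.
Context {R : realType} {X : pmetricType R}.
Implicit Types (x y z : X) (r s : R).

Lemma mdist_lipschitz x y z : `|mdist x y - mdist x z| <= mdist y z.
Proof.
rewrite ler_norml; apply/andP; split.
  by rewrite lerNl opprB lerBlDl; exact: metric_triangle.
by rewrite lerBlDl (metric_sym y z); exact: metric_triangle.
Qed.

Lemma open_mdist_ball x r : open [set y | mdist x y < r].
Proof.
rewrite openE => y /= xyr; apply/nbhs_ballP; exists (r - mdist x y) => /=.
  by rewrite subr_gt0.
move=> z; rewrite ballEmdist/= ltrBrDl => yz.
by rewrite (le_lt_trans (metric_triangle x y z)).
Qed.

Lemma measurable_lt_mdist x r :
  measurable ([set y | mdist x y < r] : set (borel X)).
Proof. by apply: sub_sigma_algebra; exact: open_mdist_ball. Qed.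

Lemma measurable_ge_mdist x r :
  measurable ([set y | r <= mdist x y] : set (borel X)).
Proof.
rewrite (_ : mkset _ = ~` [set y | mdist x y < r]).
  by apply: measurableC; exact: measurable_lt_mdist.
by apply/seteqP; split=> y /=; rewrite leNgt => /negP.
Qed.

Lemma measurable_metric_ball x r : measurable (ball x r : set (borel X)).
Proof. by rewrite ballEmdist; exact: measurable_lt_mdist. Qed.

Lemma le_measure_ball (m : {measure set (borel X) -> \bar R}) x r s :
  r <= s -> (m (ball x r) <= m (ball x s))%E.
Proof.
move=> rs; apply: le_measure; rewrite ?inE.
- exact: measurable_metric_ball.
- exact: measurable_metric_ball.
- exact: le_ball.
Qed.

Lemma measurable_fun_lt_preimage d (T : measurableType d) (f : T -> R) :
  (forall r, measurable [set t | f t < r]) -> measurable_fun setT f.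
Proof.
move=> mf; apply: (measurability _ (RGenInftyO.measurableE R)).
move=> _ [_ [r ->] <-]; rewrite setTI.
by rewrite (_ : _ @^-1` _ = [set t | f t < r])//; apply/seteqP;
  split=> t /=; rewrite in_itv.
Qed.

Lemma measurable_mdist x : measurable_fun setT (fun y : borel X => mdist x y).
Proof. by apply: measurable_fun_lt_preimage => r; exact: measurable_lt_mdist. Qed.

(** Measurability of the distance for the product sigma-algebra needs
    separability: [d(y, z) < r] is detected by the countably many conditions
    [d(q, y) + d(q, z) < r] with [q] in a dense set. *)
Lemma measurable_mdist2 : separable X ->
  measurable_fun setT (fun p : borel X * borel X => mdist (p.1 : X) (p.2 : X)).
Proof.
move=> [A [cA dA]]; apply: measurable_fun_lt_preimage => r.
rewrite (_ : [set _ | _] = \bigcup_(q in [set: A])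
    [set p : borel X * borel X |
      mdist (\val q) (p.1 : X) + mdist (\val q) (p.2 : X) < r]).
  apply: countable_bigcupT_measurable => [|q].
    by rewrite (eq_countable (card_setT A)).
  rewrite -[X in measurable X]setTI.
  rewrite (_ : [set _ | _] = (fun p : borel X * borel X =>
      mdist (\val q) (p.1 : X) + mdist (\val q) (p.2 : X)) @^-1` `]-oo, r[).
    apply: measurable_funD => //.
      exact: measurableT_comp (measurable_mdist (\val q)) (@measurable_fst _ _ _ _).
    exact: measurableT_comp (measurable_mdist (\val q)) (@measurable_snd _ _ _ _).
  by apply/seteqP; split=> p /=; rewrite in_itv.
apply/seteqP; split=> [[y z] /= yzr|[y z] [q _] /=]; last first.
  by apply: le_lt_trans; rewrite (metric_sym _ y); exact: metric_triangle.
have e0 : 0 < (r - mdist y z) / 2 by rewrite divr_gt0// subr_gt0.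
have [] := dA (ball y ((r - mdist y z) / 2)).
- by exists y; exact: (ball_center y (PosNum e0)).
- by rewrite ballEmdist; exact: open_mdist_ball.
move=> q [yq Aq]; exists (SigSub (mem_set Aq)) => //=.
have := metric_triangle q y z; move: yq; rewrite ballEmdist/= (metric_sym q y).
lra.
Qed.

End metric_measurability.

(** * Wasserstein distance from a point mass *)

Section wasserstein_from_a_point.
Context {R : realType} {X : pmetricType R}.
Hypothesis sepX : separable X.
Implicit Types (x : X) (mu nu : probability (borel X) R).
Local Open Scope ereal_scope.

Local Notation point_mass x := (\d_(x : borel X) : probability (borel X) R).

Let msqd x : measurable_fun setT (fun y : borel X => ((mdist x y) ^+ 2)%:E).
Proof. by apply/measurable_EFinP/measurable_funX; exact: measurable_mdist. Qed.

Let msqd2 : measurable_fun setT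
  (fun p : borel X * borel X => ((mdist (p.1 : X) (p.2 : X)) ^+ 2)%:E).
Proof. by apply/measurable_EFinP/measurable_funX; exact: measurable_mdist2. Qed.

Let sqd_ge0 x y : 0 <= ((mdist x y) ^+ 2)%:E :> \bar R.
Proof. by rewrite lee_fin sqr_ge0. Qed.

Lemma coupling_integral1 mu nu p (f : borel X -> \bar R) : coupling mu nu p ->
  measurable_fun setT f -> (forall y, 0 <= f y) ->
  \int[p]_z f z.1 = \int[mu]_y f y.
Proof.
move=> [p1 _] mf f0.
have := @ge0_integral_pushforward _ _ _ _ R fst (@measurable_fst _ _ _ _) p
  setT f measurableT mf (fun y _ => f0 y).
rewrite preimage_setT => <-; apply: eq_measure_integral => A mA _.
rewrite /pushforward; apply: etrans (p1 A mA); congr (p _).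
by apply/seteqP; split=> z //= -[].
Qed.

Lemma coupling_integral2 mu nu p (f : borel X -> \bar R) : coupling mu nu p ->
  measurable_fun setT f -> (forall y, 0 <= f y) ->
  \int[p]_z f z.2 = \int[nu]_y f y.
Proof.
move=> [_ p2] mf f0.
have := @ge0_integral_pushforward _ _ _ _ R snd (@measurable_snd _ _ _ _) p
  setT f measurableT mf (fun y _ => f0 y).
rewrite preimage_setT => <-; apply: eq_measure_integral => A mA _.
rewrite /pushforward; apply: etrans (p2 A mA); congr (p _).
by apply/seteqP; split=> z //= -[].
Qed.

Lemma product_coupling mu nu :
  coupling mu nu ((mu \x nu) : probability (borel X * borel X)%type R).
Proof.
split=> A mA; apply: etrans (product_measure1E _ _ _ _) _ => //.
  by rewrite [X in _ * X](probability_setT nu) mule1.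
by rewrite [X in X * _](probability_setT mu) mul1e.
Qed.

Lemma sqr_mdist_le x y z :
  ((mdist x z ^+ 2)%:E <=
    2%:E * (mdist y x ^+ 2)%:E + 2%:E * (mdist y z ^+ 2)%:E :> \bar R).
Proof.
rewrite -!EFinM -EFinD lee_fin.
have := metric_triangle x y z; rewrite (metric_sym x y).
have := mdist_ge0 x z; have := mdist_ge0 y x; have := mdist_ge0 y z.
have := sqr_ge0 (mdist y x - mdist y z); nra.
Qed.

Lemma P2_second_moment mu x : P2 mu ->
  \int[mu]_y ((mdist x (y : X)) ^+ 2)%:E < +oo.
Proof.
move=> [y hy].
apply: (@le_lt_trans _ _
    (\int[mu]_z (2%:E * (mdist y x ^+ 2)%:E + 2%:E * (mdist y (z : X) ^+ 2)%:E))).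
  apply: ge0_le_integral => //.
    apply: emeasurable_funD => //.
    exact: measurable_funeM.
  by move=> z _; exact: sqr_mdist_le.
rewrite ge0_integralD//; last 3 first.
- by move=> z _; rewrite mule_ge0.
- by move=> z _; rewrite mule_ge0.
- exact: measurable_funeM.
rewrite integral_cst// [X in _ * X + _](probability_setT mu) mule1 ge0_integralZl//.
by rewrite lte_add_pinfty// ?lte_mul_pinfty// ltry.
Qed.

(** The only coupling with a Dirac mass at [x] transports every point to [x]. *)
Lemma coupling_dirac_cost x mu p : coupling (point_mass x) mu p ->
  \int[p]_z ((mdist (z.1 : X) (z.2 : X)) ^+ 2)%:E =
  \int[mu]_y ((mdist x (y : X)) ^+ 2)%:E.
Proof.
move=> pc; rewrite -(coupling_integral2 pc)//.
have mx : measurable ([set x] : set (borel X)).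
  rewrite (_ : [set x] = \bigcap_(n in [set: nat]) (ball x n.+1%:R^-1 : set (borel X))).
    by apply: bigcapT_measurable => n; exact: measurable_metric_ball.
  apply/seteqP; split=> [_ -> n _|y xy].
    by rewrite ballEmdist/= mdistxx.
  apply/esym/mdist_positivity; apply/eqP; rewrite eq_le mdist_ge0 andbT leNgt.
  apply/negP => d0; have := xy (Num.truncn (mdist x y)^-1) I.
  rewrite ballEmdist/= ltNge => /negP; apply.
  by rewrite invf_ple ?posrE// ltW// truncnS_gt.
apply: ae_eq_integral => //.
  exact: measurableT_comp (msqd x) (@measurable_snd _ _ _ _).
exists (~` [set x] `*` setT); split.
- by apply: measurableX => //; exact: measurableC.
- apply: etrans (pc.1 _ _) _; first exact: measurableC.
  by rewrite /= diracE memNset//= => /(_ erefl).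
- move=> [y z] /= h; split=> //= yx; apply: h => _; by rewrite yx.
Qed.

Lemma W2_dirac x mu : P2 mu ->
  ((W2 (point_mass x) mu) ^+ 2)%:E = \int[mu]_y ((mdist x (y : X)) ^+ 2)%:E.
Proof.
move=> mu2; rewrite /W2.
set S := [set _ | _ in _].
have -> : S = [set \int[mu]_y ((mdist x (y : X)) ^+ 2)%:E].
  apply/seteqP; split=> [_ [p pc <-]|_ ->] /=.
    exact: coupling_dirac_cost.
  by exists (point_mass x \x mu); [exact: product_coupling|
    exact/coupling_dirac_cost/product_coupling].
rewrite ereal_inf1 sqr_sqrtr; last by rewrite fine_ge0// integral_ge0.
by rewrite fineK// ge0_fin_numE ?integral_ge0// P2_second_moment.
Qed.

Lemma W2_near_optimal mu nu (e : R) : P2 mu -> P2 nu -> (0 < e)%R ->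
  exists2 p, coupling mu nu p &
    \int[p]_z ((mdist (z.1 : X) (z.2 : X)) ^+ 2)%:E <= (W2 mu nu ^+ 2 + e)%:E.
Proof.
move=> mu2 nu2 e0; rewrite /W2; set S := [set _ | _ in _].
have S0 : 0 <= ereal_inf S.
  by apply: le_ereal_inf_tmp => _ [p _ <-]; exact: integral_ge0.
have Sfin : ereal_inf S \is a fin_num.
  rewrite ge0_fin_numE//.
  apply: (@le_lt_trans _ _
      (\int[mu \x nu]_z ((mdist (z.1 : X) (z.2 : X)) ^+ 2)%:E)).
    by apply: ereal_inf_lbound; exists (mu \x nu) => //; exact: product_coupling.
  have [y hy] := mu2.
  apply: (@le_lt_trans _ _ (\int[mu \x nu]_z
    (2%:E * (mdist y (z.1 : X) ^+ 2)%:E + 2%:E * (mdist y (z.2 : X) ^+ 2)%:E))).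
    apply: ge0_le_integral => //.
      apply: emeasurable_funD; apply: measurable_funeM.
        exact: measurableT_comp (msqd y) (@measurable_fst _ _ _ _).
      exact: measurableT_comp (msqd y) (@measurable_snd _ _ _ _).
    by move=> z _; exact: sqr_mdist_le.
  rewrite ge0_integralD//; last 4 first.
  - by move=> z _; rewrite mule_ge0.
  - apply: measurable_funeM.
    exact: measurableT_comp (msqd y) (@measurable_fst _ _ _ _).
  - by move=> z _; rewrite mule_ge0.
  - apply: measurable_funeM.
    exact: measurableT_comp (msqd y) (@measurable_snd _ _ _ _).
  rewrite !ge0_integralZl//; last 2 first.
  - exact: measurableT_comp (msqd y) (@measurable_snd _ _ _ _).
  - exact: measurableT_comp (msqd y) (@measurable_fst _ _ _ _).
  rewrite (coupling_integral1 (product_coupling mu nu) (msqd y))//.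
  rewrite (coupling_integral2 (product_coupling mu nu) (msqd y))//.
  by rewrite lte_add_pinfty// lte_mul_pinfty// P2_second_moment.
have : ereal_inf S < ereal_inf S + e%:E by rewrite lteDl// lte_fin.
move=> /ereal_inf_lt[_ [p pc <-] pe]; exists p => //.
by rewrite sqr_sqrtr ?fine_ge0// EFinD fineK// ltW.
Qed.

(** Along a constant-speed interpolation from the point [x] to [nu], the
    triangle inequality is almost an equality for nearly optimal couplings.
    Quantitatively, with [a = d(x,y)], [b = d(y,z)] and [c = d(x,z)] one has
    [(1-t) a^2 + t b^2 >= t (1-t) c^2 + (a - t c)^2] because [b >= |a - c|];
    when this inequality is integrated against an almost optimal coupling of
    [mu] and [nu], the term [(a - t c)^2] has arbitrarily small integral. Hence
    [mu] lives at distance at most [t] times the radius of the support of [nu]. *)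
Lemma W2_interpolant_concentrated x mu nu (t rho r : R) :
  P2 mu -> P2 nu -> (0 < t < 1)%R ->
  W2 (point_mass x) mu = (t * W2 (point_mass x) nu)%R ->
  W2 mu nu = ((1 - t) * W2 (point_mass x) nu)%R ->
  nu [set y | rho <= mdist x (y : X)]%R = 0 -> (t * rho < r)%R ->
  mu [set y | r <= mdist x (y : X)]%R = 0.
Proof.
move=> mu2 nu2 /andP[t0 t1] xmu munu nu0 rho_r.
set W := W2 (point_mass x) nu in xmu munu *.
have mge (s : R) : measurable ([set y | s <= mdist x (y : X)]%R : set (borel X)).
  exact: measurable_ge_mdist.
have eta0 : (0 < r - t * rho)%R by rewrite subr_gt0.
set eta := (r - t * rho)%R in eta0.
apply/eqP; rewrite eq_le measure_ge0 andbT; apply/lee_addgt0Pr => e e0.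
rewrite add0e.
have [|p pc pe] := @W2_near_optimal mu nu (eta ^+ 2 * e / t)%R mu2 nu2.
  by rewrite divr_gt0// mulr_gt0// exprn_gt0.
pose far := ([set y | r <= mdist x (y : X)]%R `*` [set y | mdist x (y : X) < rho]%R :
  set (borel X * borel X)).
have mfar : measurable far.
  by apply: measurableX; [exact: mge|exact: measurable_lt_mdist].
have ma : measurable_fun setT
    (fun z : borel X * borel X => (mdist x (z.1 : X) ^+ 2)%:E).
  exact: measurableT_comp (msqd x) (@measurable_fst _ _ _ _).
have mc : measurable_fun setT
    (fun z : borel X * borel X => (mdist x (z.2 : X) ^+ 2)%:E).
  exact: measurableT_comp (msqd x) (@measurable_snd _ _ _ _).
have mi : measurable_fun setT (fun z => (\1_far z)%:E : \bar R).
  by apply/measurable_EFinP; exact: measurable_indic.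
have t'0 : (0 < 1 - t)%R by rewrite subr_gt0.
have key : \int[p]_z ((t * (1 - t))%:E * (mdist x (z.2 : X) ^+ 2)%:E +
      (eta ^+ 2)%:E * (\1_far z)%:E) <=
    \int[p]_z ((1 - t)%:E * (mdist x (z.1 : X) ^+ 2)%:E +
      t%:E * (mdist (z.1 : X) (z.2 : X) ^+ 2)%:E).
  apply: ge0_le_integral => //.
  - move=> z _; rewrite adde_ge0// mule_ge0// lee_fin ?sqr_ge0//.
    by rewrite mulr_ge0// ltW.
  - by apply: emeasurable_funD; exact: measurable_funeM.
  - by apply: emeasurable_funD; exact: measurable_funeM.
  move=> z _; rewrite -!EFinM -!EFinD lee_fin.
  set a := mdist x z.1; set b := mdist z.1 z.2; set c := mdist x z.2.
  have b_ac : ((a - c) ^+ 2 <= b ^+ 2)%R.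
    rewrite -real_normK ?num_real// lerXn2r ?nnegrE ?mdist_ge0//.
    exact: mdist_lipschitz.
  have far_ac : (eta ^+ 2 * \1_far z <= (a - t * c) ^+ 2)%R.
    rewrite indicE; case: (boolP (z \in far)) => [|_]; last by rewrite mulr0 sqr_ge0.
    rewrite inE => -[/= ra crho]; rewrite mulr1 lerXn2r ?nnegrE//.
    - exact: ltW.
    - rewrite subr_ge0 (le_trans _ ra)// (le_trans _ (ltW rho_r))//.
      by rewrite ler_pM2l// ltW.
    - by rewrite lerB// ler_pM2l// ltW.
  have -> : (t * (1 - t) * c ^+ 2 + eta ^+ 2 * \1_far z =
    (1 - t) * a ^+ 2 + t * (a - c) ^+ 2 - ((a - t * c) ^+ 2 - eta ^+ 2 * \1_far z))%R by ring.
  by rewrite lerBlDr ler_wpDr ?subr_ge0// lerD2l ler_pM2l.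
move: key; rewrite !ge0_integralD//; last 8 first.
- by move=> z _; rewrite mule_ge0// lee_fin ltW.
- exact: measurable_funeM.
- by move=> z _; rewrite mule_ge0// lee_fin ltW.
- exact: measurable_funeM.
- by move=> z _; rewrite mule_ge0// lee_fin mulr_ge0 ?ltW.
- exact: measurable_funeM.
- by move=> z _; rewrite mule_ge0// lee_fin sqr_ge0.
- exact: measurable_funeM.
rewrite !ge0_integralZl//; last first; try by [rewrite lee_fin ltW|rewrite lee_fin mulr_ge0 ?ltW].
rewrite (coupling_integral1 pc (msqd x))// (coupling_integral2 pc (msqd x))//.
rewrite -!W2_dirac// -/W xmu integral_indic// setIT => key.
have pfar : p far <= e%:E.
  have pfin : p far \is a fin_num by exact: fin_num_measure.
  have pE : p far = (fine (p far))%:E by rewrite fineK.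
  move: key pe; rewrite munu [X in X <= e%:E]pE [X in _ + _ * X <= _]pE.
  rewrite -!EFinM -EFinD.
  move=> /le_trans key /(lee_wpmul2l (_ : 0 <= t%:E)).
  rewrite lee_fin => /(_ (ltW t0)) /(leeD2l ((1 - t)%:E * ((t * W) ^+ 2)%:E)) /key.
  rewrite -!EFinM -EFinD !lee_fin => {}key.
  rewrite -(ler_pM2l (exprn_gt0 2 eta0)) -subr_ge0.
  suff -> : (eta ^+ 2 * e - eta ^+ 2 * fine (p far))%R =
    ((1 - t) * (t * W) ^+ 2 + t * (((1 - t) * W) ^+ 2 + eta ^+ 2 * e / t) -
     (t * (1 - t) * W ^+ 2 + eta ^+ 2 * fine (p far)))%R by rewrite subr_ge0.
  by field; rewrite gt_eqF.
rewrite -(pc.1 _ (mge r)); apply: le_trans pfar.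
apply: (@le_trans _ _ (p (far `|` setT `*` [set y | rho <= mdist x (y : X)]%R))).
  apply: le_measure; rewrite ?inE//.
  - exact: measurableX.
  - by apply: measurableU => //; exact: measurableX.
  move=> [y z] [/= ry _]; case: (ltP (mdist x z) rho) => xz; first by left.
  by right.
apply: le_trans (measureU2 _ _ _) _ => //; first exact: measurableX.
by rewrite [X in _ + X](pc.2 _ (mge rho)) nu0 adde0.
Qed.

End wasserstein_from_a_point.

(** * Entropy and volume *)

Section entropy_bounds.
Context {R : realType} {X : pmetricType R}.
Variable m : {measure set (borel X) -> \bar R}.
Implicit Types (mu : probability (borel X) R) (A B : set (borel X)).
Local Open Scope ereal_scope.

Lemma uniform_probability B : measurable B -> 0 < m B < +oo ->
  exists mu, forall A, mu A = m (A `&` B) * ((fine (m B))^-1)%:E.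
Proof.
move=> mB /andP[B0 Boo].
exists (mnormalize (mrestr m mB) (\d_(point : borel X))) => A.
by rewrite /= /mnormalize /= /mrestr setTI gt_eqF// lt_eqF.
Qed.

Lemma entropy_uniform_le B mu : measurable B -> 0 < m B < +oo ->
  (forall A, mu A = m (A `&` B) * ((fine (m B))^-1)%:E) ->
  entropy m mu <= (- ln (fine (m B)))%:E.
Proof.
move=> mB /andP[B0 Boo] muE; set V := fine (m B).
have V0 : (0 < V)%R by rewrite fine_gt0// B0.
have mBE : m B = V%:E by rewrite fineK// gt0_fin_numE.
have ln0V : (0 < V^-1)%R by rewrite invr_gt0.
pose rho := (fun y : borel X => V^-1 * \1_B y)%R.
have mrho : measurable_fun setT rho.
  by apply: measurable_funM => //; exact: measurable_indic.
have rho_gt0 : [set y | 0 < rho y]%R = B.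
  apply/seteqP; split=> y /=; rewrite /rho indicE.
    by case: (boolP (y \in B)) => [|_]; rewrite ?inE// mulr0 ltxx.
  by move=> By; rewrite mem_set// mulr1.
have intB A (c : R) : (0 <= c)%R -> measurable A -> \int[m]_(y in A) (c * \1_B y)%:E = c%:E * m (A `&` B).
  move=> c0 mA; rewrite (_ : (fun y => _) = (fun y => c%:E * (\1_B y)%:E)) //.
  rewrite ge0_integralZl//; last exact/measurable_EFinP/measurable_indic.
  by rewrite integral_indic// setIC.
apply: ge_ereal_inf; exists (\int[m]_(y in [set y | 0 < rho y]%R) (rho y * ln (rho y))%:E).
  exists rho => //; split=> //.
  - by move=> y; rewrite mulr_ge0// ltW.
  - by move=> A mA; rewrite intB// 1?ltW// muleC muE.
  - rewrite (_ : (fun y => _) = (fun y => (Num.max (V^-1 * ln V^-1) 0 * \1_B y)%:E)).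
      by rewrite intB ?le_max ?lexx ?orbT// setTI mBE -EFinM ltry.
    apply/funext => y; rewrite /rho indicE; case: (y \in B); rewrite ?mulr1//.
    by rewrite !mulr0 mul0r maxxx.
rewrite rho_gt0 (eq_integral (fun=> (V^-1 * ln V^-1)%:E)); last first.
  by move=> y yB; rewrite /rho indicE yB mulr1.
rewrite integral_cst// mBE -EFinM lnV ?posrE// lee_fin mulrAC mulVf ?mul1r//.
by rewrite gt_eqF.
Qed.

(** Jensen's inequality for [u ln u], in the form of the tangent-line bound
    [u ln u >= u - 1] applied to [u = rho m(A)]: among the probability measures
    carried by [A] the uniform one has the least entropy. *)
Lemma entropy_ge A mu : measurable A -> 0 < m A < +oo -> mu (~` A) = 0 ->
  (- ln (fine (m A)))%:E <= entropy m mu.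
Proof.
move=> mA /andP[A0 Aoo] muA'; set V := fine (m A).
have V0 : (0 < V)%R by rewrite fine_gt0// A0.
have mAE : m A = V%:E by rewrite fineK// gt0_fin_numE.
have muA : mu A = 1.
  have : mu (A `|` ~` A) = mu A + mu (~` A).
    by apply: measureU; [|exact: measurableC|exact: setICr].
  by rewrite muA' adde0 setUv probability_setT.
apply: le_ereal_inf_tmp => _ [rho [mrho rho0 muE rhoE] <-].
set f := (fun y => rho y * ln (rho y))%R in rhoE *.
have mf : measurable_fun setT f.
  by apply: measurable_funM => //; exact: measurableT_comp.
have mpos : measurable [set y | (0 < rho y)%R].
  rewrite -[X in measurable X]setTI.
  rewrite (_ : [set _ | _] = rho @^-1` `]0%R, +oo[).
    exact: mrho.
  by apply/seteqP; split=> y /=; rewrite in_itv/= andbT.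
have -> : \int[m]_(y in [set y | (0 < rho y)%R]) (f y)%:E = \int[m]_(y in A) (f y)%:E.
  rewrite integral_mkcond [RHS]integral_mkcond.
  apply: ae_eq_integral => //.
  - by apply/(measurable_restrictT _ _).1 => //; exact/measurable_EFinP/measurable_funTS.
  - by apply/(measurable_restrictT _ _).1 => //; exact/measurable_EFinP/measurable_funTS.
  have : ae_eq m (~` A) (EFin \o rho) (cst 0).
    apply/ae_eq_integral_abs; first exact: measurableC.
      exact/measurable_EFinP/measurable_funTS.
    rewrite -[RHS]muA' muE; last exact: measurableC.
    by apply: eq_integral => y _; rewrite /= ger0_norm.
  apply: filterS => y /= h _; rewrite !patchE.
  case: (boolP (y \in A)) => yA.
    case: ifPn => //; rewrite notin_setE/= => /negP; rewrite -leNgt => rho_le0.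
    have r0 : rho y = 0%R by apply/eqP; rewrite eq_le rho_le0 rho0.
    by rewrite /f r0 mul0r.
  have /h[rhoy] : (~` A) y by move=> Ay; rewrite mem_set in yA.
  by case: ifPn => // _; rewrite /f rhoy mul0r.
have rhoA : \int[m]_(y in A) (rho y)%:E = 1 by rewrite -muE.
have irho : m.-integrable A (EFin \o rho).
  apply/integrableP; split; first exact/measurable_EFinP/measurable_funTS.
  under eq_integral do rewrite /= ger0_norm//.
  by rewrite rhoA ltry.
have icst (c : R) : m.-integrable A (EFin \o cst c).
  apply/integrableP; split; first exact/measurable_EFinP/measurable_cst.
  by rewrite /= integral_cst// mAE -EFinM ltry.
set c := (1 - ln V)%R.
have ig : m.-integrable A (fun y => c%:E * (rho y)%:E - (V^-1)%:E).
  by apply: integrableB => //; [exact: integrableZl|exact: icst].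
have gf y : (c * rho y - V^-1 <= f y)%R.
  rewrite /f; have := rho0 y; rewrite le_eqVlt => /predU1P[<-|rhoy].
    by rewrite mulr0 mul0r sub0r oppr_le0 invr_ge0 ltW.
  have := @le_ln1Dx R ((rho y * V)^-1 - 1).
  rewrite ltrBDl subrr invr_gt0 mulr_gt0// addrC subrK => /(_ isT).
  rewrite lnV ?posrE ?mulr_gt0// lnM ?posrE// => /(ler_wpM2l (ltW rhoy)).
  rewrite mulrBr mulr1 invfM mulrA divff ?gt_eqF// mul1r /c.
  nra.
rewrite [leLHS](_ : _ = \int[m]_(y in A) (c%:E * (rho y)%:E - (V^-1)%:E)); last first.
  rewrite integralB//; [|exact: integrableZl|exact: icst].
  rewrite integralZl// rhoA mule1 integral_cst// mAE -EFinM mulVf ?gt_eqF//.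
  by rewrite -EFinB /c addrAC subrr sub0r.
apply: le_integral => //; last by move=> y _; rewrite -EFinM -EFinB lee_fin.
apply: (@le_integrable _ _ _ _ _ _ _
    (fun y => (Num.max (f y) 0)%:E + `|c%:E * (rho y)%:E - (V^-1)%:E|)) => //.
- exact/measurable_EFinP/measurable_funTS.
- move=> y _; rewrite -EFinM -EFinB /= lee_fin.
  have gfy := gf y; set g := (c * rho y - V^-1)%R in gfy *.
  have max_ge0 : (0 <= Num.max (f y) 0)%R by rewrite le_max lexx orbT.
  have max_gef : (f y <= Num.max (f y) 0)%R by rewrite le_max lexx.
  have g_ge := ler_norm (- g); rewrite normrN in g_ge.
  rewrite [leRHS]ger0_norm ?addr_ge0// ler_norml; apply/andP; split.
    by rewrite lerNl; lra.
  by rewrite (le_trans max_gef)// lerDl.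
- apply: integrableD => //; last exact: integrable_abse.
  apply: (@integrableS _ _ _ _ setT) => //.
  apply/integrableP; split; first exact/measurable_EFinP/measurable_maxr.
  rewrite (le_lt_trans _ rhoE)// le_eqVlt; apply/orP; left; apply/eqP; apply: eq_integral => y _ /=.
  by rewrite ger0_norm// le_max lexx orbT.
Qed.
End entropy_bounds.

(** * Distortion coefficients *)

Section distortion_coefficients.
Context {R : realType}.
Implicit Types K N t theta u a : R.

Lemma sin_ge_mul_cos u a : 0 <= u <= a -> a <= pi / 2 -> u * cos a <= sin u.
Proof.
move=> /andP[+ ua] api; have pi0 := @pi_ge0 R; rewrite le_eqVlt => /predU1P[<-|u0].
  by rewrite mul0r sin0.
have [|c] := @MVT R sin cos 0 u u0 (fun x _ => is_derive_sin x).
  exact/continuous_subspaceT/continuous_sin.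
rewrite in_itv/= sin0 !subr0 => /andP[c0 cu] ->; rewrite mulrC ler_pM2r// ltW//.
rewrite ltr_cos ?(lt_le_trans cu)// in_itv/=; apply/andP; split; lra.
Qed.

Lemma sinh_ge u : 0 <= u -> u / 2 <= sinh u.
Proof.
move=> u0; rewrite /sinh ler_pM2r// lerBrDr.
have := expR_ge1Dx u; have : expR (- u) <= 1 by rewrite -expR0 ler_expR oppr_le0.
lra.
Qed.

(** For a fixed distance [theta] the distortion coefficient is at least linear
    in [t], which is the only feature of it that matters for the volume of
    small balls. The bound on [theta] keeps the sine away from its zeros. *)
Lemma sigma_ge_linear K N theta : 0 < N -> 0 <= theta ->
  4 * K * theta ^+ 2 <= N ->
  exists2 c : R, 0 < c &
    forall t, 0 <= t <= 1 -> ((c * t)%:E <= sigma K N t theta)%E.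
Proof.
move=> N0 th0 KN; rewrite /sigma.
have [big|_] := leP (N * pi ^+ 2) (K * theta ^+ 2).
  by exists 1 => // t _; rewrite leey.
have [Kpos|Knpos] := ltP 0 (K * theta ^+ 2).
  have th_gt0 : 0 < theta.
    rewrite lt_neqAle th0 andbT; apply/eqP => th; move: Kpos.
    by rewrite -th expr0n mulr0 ltxx.
  have K0 : 0 < K by rewrite -(pmulr_lgt0 _ (exprn_gt0 2 th_gt0)).
  set a := theta * Num.sqrt (K / N).
  have a0 : 0 < a by rewrite mulr_gt0// sqrtr_gt0 divr_gt0.
  have a1 : a <= 1 / 2.
    have aa : a ^+ 2 <= (1 / 2) ^+ 2.
      rewrite exprMn sqr_sqrtr; last by rewrite divr_ge0 ?ltW.
      by rewrite mulrA ler_pdivrMr//; lra.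
    by move: aa; rewrite ler_pXn2r// nnegrE// ltW.
  have pi2 := @pi_ge2 R.
  have sina0 : 0 < sin a by apply: sin_gt0_pi; apply/andP; split; lra.
  have cosa0 : 0 < cos a by apply: cos_gt0_pihalf; apply/andP; split; lra.
  exists (a * cos a / sin a).
    by rewrite divr_gt0// mulr_gt0.
  move=> t /andP[t0 t1].
  rewrite lee_fin mulrAC ler_pM2r ?invr_gt0//.
  rewrite -(mulrA t) -/a mulrC mulrA; apply: sin_ge_mul_cos; last by lra.
  by rewrite (mulr_ge0 t0 (ltW a0))/= ger_pMl.
have [_|Kn0] := eqVneq (K * theta ^+ 2) 0; first by exists 1 => // t _; rewrite mul1r.
have Kneg : K * theta ^+ 2 < 0 by rewrite lt_neqAle Kn0.
have th_gt0 : 0 < theta.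
  rewrite lt_neqAle th0 andbT; apply/eqP => th; move: Kneg.
  by rewrite -th expr0n mulr0 ltxx.
have K0 : 0 < - K.
  by rewrite oppr_gt0 -(pmulr_llt0 _ (exprn_gt0 2 th_gt0)).
set a := theta * Num.sqrt (- K / N).
have a0 : 0 < a by rewrite mulr_gt0// sqrtr_gt0 divr_gt0.
have sa0 : 0 < sinh a by rewrite (lt_le_trans _ (sinh_ge (ltW a0)))// divr_gt0.
exists (a / 2 / sinh a); first by rewrite divr_gt0// divr_gt0.
move=> t /andP[t0 t1]; rewrite lee_fin mulrAC ler_pM2r ?invr_gt0//.
rewrite -(mulrA t) -/a; apply: le_trans (sinh_ge _); first by rewrite mulrAC (mulrC a).
by rewrite mulr_ge0// ltW.
Qed.

End distortion_coefficients.

(** * Volume growth under the curvature-dimension condition *)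

Section lower_volume_bound.
Context {R : realType} {X : pmetricType R}.
Hypothesis sepX : separable X.
Variable m : {measure set (borel X) -> \bar R}.
Implicit Types (x : X) (mu nu : probability (borel X) R).

Local Notation point_mass x := (\d_(x : borel X) : probability (borel X) R).

Lemma point_mass_P2 x : P2 (point_mass x).
Proof.
exists x; rewrite integral_dirac//.
  by rewrite mdistxx expr0n mule0 ltry.
by apply/measurable_EFinP/measurable_funX; exact: measurable_mdist.
Qed.

Lemma second_moment_le nu x (rho : R) : 0 <= rho ->
  nu [set y | rho <= mdist x (y : X)] = 0%E ->
  (\int[nu]_y (mdist x (y : X) ^+ 2)%:E <= (rho ^+ 2)%:E)%E.
Proof.
move=> rho0 nu0; rewrite -[leRHS]mule1 -(probability_setT nu) -integral_cst//.
apply: ae_ge0_le_integral => //.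
- by move=> y _; rewrite lee_fin sqr_ge0.
- by apply/measurable_EFinP/measurable_funX; exact: measurable_mdist.
- by move=> y _; rewrite lee_fin sqr_ge0.
exists [set y | rho <= mdist x (y : X)]; split => //.
  exact: measurable_ge_mdist.
move=> y /= h; rewrite leNgt; apply/negP => yrho; apply: h => _.
by rewrite lee_fin lerXn2r ?nnegrE ?mdist_ge0// ltW.
Qed.

(** A Brunn-Minkowski inequality with one set reduced to the point [x]. Entropic
    convexity is applied to a geodesic from the Dirac mass at [x] to the uniform
    measure on [ball x rho]. The term of the Dirac mass is nonnegative; the term
    of the uniform measure contributes the volume of [ball x rho]; the entropy
    at time [t] bounds the volume of [ball x r] from below by Jensen's
    inequality, because the interpolant is carried by that ball. *)
Lemma CDe_ball_growth K N x (rho : R) : CDe K N m -> 0 < N -> 0 < rho ->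
  4 * K * rho ^+ 2 <= N -> (0 < m (ball x rho) < +oo)%E ->
  exists2 c : R, 0 < c & forall t r, 0 < t < 1 -> t * rho < r ->
    (0 < m (ball x r) < +oo)%E ->
    c * t <= expR (ln (fine (m (ball x r))) / N).
Proof.
move=> [_ conv] N0 rho0 Krho mB.
have mball r : measurable (ball x r : set (borel X)) by exact: measurable_metric_ball.
have [nu nuE] := uniform_probability (mball rho) mB.
have nu_far : nu [set y | rho <= mdist x (y : X)] = 0%E.
  rewrite nuE (_ : _ `&` _ = set0) ?measure0 ?mul0e//.
  by apply/seteqP; split=> // y /=; rewrite ballEmdist/= => -[/le_lt_trans h /h]; rewrite ltxx.
have nu2 : P2 nu.
  by exists x; rewrite (le_lt_trans (second_moment_le (ltW rho0) nu_far))// ltry.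
set W := W2 (point_mass x) nu.
have W0 : 0 <= W by rewrite sqrtr_ge0.
have W_rho : W ^+ 2 <= rho ^+ 2.
  by rewrite -lee_fin /W W2_dirac//; exact: second_moment_le (ltW rho0) nu_far.
have KW : 4 * K * W ^+ 2 <= N.
  have [K0|K0] := leP K 0; last by rewrite (le_trans _ Krho)// ler_pM2l// mulr_gt0.
  by rewrite (le_trans _ (ltW N0))// -mulrA mulr_ge0_le0// mulr_le0_ge0// sqr_ge0.
have [c c0 cE] := sigma_ge_linear N0 W0 KW.
exists (c * expR (ln (fine (m (ball x rho))) / N)); first by rewrite mulr_gt0// expR_gt0.
move=> t r /andP[t0 t1] rho_r mBr.
have t01 : 0 <= t <= 1 by rewrite !ltW.
have [y [y0 y1 yP2 yg /(_ t t01)]] := conv _ _ (point_mass_P2 x) nu2.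
have W_0t : W2 (point_mass x) (y t) = t * W.
  have := yg 0 t; rewrite y0 y1 lexx ler01 => /(_ isT t01) ->.
  by rewrite sub0r normrN gtr0_norm.
have W_t1 : W2 (y t) nu = (1 - t) * W.
  have := yg t 1; rewrite y0 y1 lexx ler01 => /(_ t01 isT) ->.
  by rewrite distrC gtr0_norm ?subr_gt0.
have yt0 : y t (~` ball x r) = 0%E.
  rewrite -(W2_interpolant_concentrated sepX (yP2 _ t01) nu2 _ W_0t W_t1 nu_far rho_r).
    by congr (y t _); rewrite ballEmdist; apply/seteqP; split=> z /=; rewrite leNgt => /negP.
  by rewrite t0.
have ent_t : (entropy m (y t) >= (- ln (fine (m (ball x r))))%:E)%E.
  exact: entropy_ge.
have ent_1 : (entropy m nu <= (- ln (fine (m (ball x rho))))%:E)%E.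
  exact: (entropy_uniform_le (mball rho)).
rewrite -lee_fin => conv_t.
have Ninv : (0 <= (N^-1)%:E)%E by rewrite lee_fin invr_ge0 ltW.
apply: (@le_trans _ _ (expeR (- (entropy m (y t) * (N^-1)%:E)))%E); last first.
  rewrite (_ : (expR _)%:E = expeR (- ((- ln (fine (m (ball x r))))%:E * (N^-1)%:E))%E).
    by rewrite lee_expeR leeN2 lee_wpmul2r.
  by rewrite -EFinM mulNr -EFinN opprK.
apply: le_trans conv_t; apply: (@le_trans _ _
    (sigma K N t W * expeR (- (entropy m nu * (N^-1)%:E)))%E); last first.
  have sigma_ge0 : (0%:E <= sigma K N (1 - t) W)%E.
    apply: (@le_trans _ _ (c * (1 - t))%:E).
      by rewrite lee_fin mulr_ge0 ?subr_ge0 ?ltW.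
    by apply: cE; rewrite subr_ge0 ltW//= gerBl ltW.
  by apply: leeDr; rewrite mule_ge0 ?expeR_ge0.
rewrite mulrAC EFinM; apply: lee_pmul => //.
- by rewrite lee_fin mulr_ge0 ?ltW.
- exact: cE.
rewrite (_ : (expR _)%:E = expeR (- ((- ln (fine (m (ball x rho))))%:E * (N^-1)%:E))%E).
  by rewrite lee_expeR leeN2 lee_wpmul2r.
by rewrite -EFinM mulNr -EFinN opprK.
Qed.

End lower_volume_bound.

Section limits_at_zero.
Context {R : realType}.
Implicit Types (f : R -> \bar R).
Local Open Scope ereal_scope.

Lemma limf_einf_le_esup f : limf_einf f 0^'+ <= limf_esup f 0^'+.
Proof.
rewrite limf_einfE limf_esupE; apply: ge_ereal_sup => _ [A FA <-].
apply: le_ereal_inf_tmp => _ [B FB <-].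
have [r [Ar Br]] := filter_ex (filterI FA FB).
by apply: (@le_trans _ _ (f r)); [apply: ereal_inf_lbound|apply: ereal_sup_ubound];
  exists r.
Qed.

Lemma limf_einf_ge_near f (a : \bar R) :
  (\forall r \near 0^'+, a <= f r) -> a <= limf_einf f 0^'+.
Proof.
move=> fa; rewrite limf_einfE; apply: le_ereal_sup_tmp.
exists (ereal_inf [set f r | r in [set r | a <= f r]]); first by exists [set r | a <= f r].
by apply: le_ereal_inf_tmp => _ [r ar <-].
Qed.

Lemma limf_esup_le_near f (a : \bar R) :
  (\forall r \near 0^'+, f r <= a) -> limf_esup f 0^'+ <= a.
Proof.
move=> fa; rewrite limf_esupE; apply: ge_ereal_inf.
exists (ereal_sup [set f r | r in [set r | f r <= a]]); first by exists [set r | f r <= a].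
by apply: ge_ereal_sup => _ [r ar <-].
Qed.

End limits_at_zero.

(** The estimate [c t <= m(ball x r)^(1/N)], read at times [t] proportional to
    [r], is a lower bound of the volume by a multiple of [r ^ N]. *)
Lemma ball_density_lower (R : realType) (K : R) (N : nat) (X : pmetricType R)
    (m : {measure set (borel X) -> \bar R}) (x : X) : (0 < N)%N ->
  separable X -> locally_finite m -> supp m x -> CDe K N%:R m ->
  (0 < limf_einf (ball_density N m x) 0^'+)%E.
Proof.
move=> N0 sepX fin mx cde.
have N0R : 0 < N%:R :> R by rewrite ltr0n.
have [r1 r10 mr1] := fin x.
have mfin r : r <= r1 -> (m (ball x r) < +oo)%E.
  by move=> rr1; apply: le_lt_trans mr1; exact: le_measure_ball.
(* The radius of the fixed ball is so small that the ball has finite measure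
   and the distortion coefficients stay away from their singularity. *)
pose rho := Num.min r1 (Num.sqrt (N%:R / (4 * `|K| + 1))).
have q0 : 0 < 4 * `|K| + 1 by rewrite ltr_wpDl// mulr_ge0.
have rho0 : 0 < rho by rewrite lt_min r10 sqrtr_gt0 divr_gt0.
have rho1 : rho <= r1 by rewrite ge_min lexx.
have Krho : 4 * K * rho ^+ 2 <= N%:R.
  have : rho ^+ 2 <= N%:R / (4 * `|K| + 1).
    rewrite -[leRHS]sqr_sqrtr ?(divr_ge0 (ltW N0R) (ltW q0))//.
    by rewrite lerXn2r ?nnegrE ?sqrtr_ge0 ?(ltW rho0)// ge_min lexx orbT.
  rewrite ler_pdivlMr//; have := ler_norm K; have := sqr_ge0 rho; nra.
have [c c0 cE] := CDe_ball_growth sepX cde N0R rho0 Krho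
  (introT andP (conj (mx _ rho0) (mfin _ rho1))).
apply: (@lt_le_trans _ _ ((c / (2 * rho)) ^+ N)%:E).
  by rewrite lte_fin exprn_gt0// divr_gt0// mulr_gt0.
apply: limf_einf_ge_near; near=> r.
have r0 : 0 < r by [].
have r_rho : r < rho by near: r; exact: nbhs_right_lt.
have mr : (0 < m (ball x r) < +oo)%E.
  by rewrite mx// mfin// (le_trans (ltW r_rho)).
have mrE : m (ball x r) = (fine (m (ball x r)))%:E by rewrite fineK// gt0_fin_numE; case/andP: mr.
rewrite /ball_density mrE -EFinM lee_fin ler_pdivlMr ?exprn_gt0// -exprMn.
have -> : fine (m (ball x r)) = expR (ln (fine (m (ball x r))) / N%:R) ^+ N.
  rewrite -expRM_natl mulrC divfK ?gt_eqF// lnK// posrE fine_gt0//.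
rewrite lerXn2r ?nnegrE ?expR_ge0//.
  by rewrite mulr_ge0// ltW// divr_gt0// mulr_gt0.
(* The growth estimate is used at the time t = r / (2 rho), for which the
   interpolant is carried by the ball of radius r / 2 < r. *)
rewrite -mulrA [_^-1 * r]mulrC; apply: cE => //.
- by rewrite divr_gt0 ?mulr_gt0//= ltr_pdivrMr ?mulr_gt0//; lra.
- have -> : r / (2 * rho) * rho = r / 2 by field; rewrite gt_eqF.
  by lra.
Unshelve. all: by end_near.
Qed.

(** * Volumes of small balls in space forms *)

Section conformal_curves.
Context {R : realType}.
Variables (K : R) (n : nat) (x y : n.-tuple R) (g : 'I_n -> R -> R).
Hypothesis gxy : sf_curve K x y g.
Implicit Types s t : R.

Let h t := \sum_(i < n) g i t ^+ 2.
Let dh t := \sum_(i < n) 2 * (g i t * (derive1 (g i) t)).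
Let den t := 1 + K / 4 * h t.
Let speed t := Num.sqrt (\sum_(i < n) derive1 (g i) t ^+ 2) / den t.

Let curve_denomE t : sf_denom K (sf_point g t) = den t.
Proof.
by rewrite /sf_denom /den /h; under eq_bigr do rewrite tnth_mktuple.
Qed.

Let den_gt0 t : 0 <= t <= 1 -> 0 < den t.
Proof. by move=> t01; rewrite -curve_denomE; case: gxy => _ _ + _ _; exact. Qed.

Let g_derive i t : is_derive t 1 (g i) (derive1 (g i) t).
Proof. by case: gxy => dg _ _ _ _; rewrite derive1E; exact/derivableP. Qed.

Let h_derive t : is_derive t 1 h (dh t).
Proof.
rewrite (_ : h = \sum_(i < n) (g i ^+ 2)); last first.
  by apply/funext => u; rewrite /h fct_sumE; apply: eq_bigr => i _; rewrite fctE.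
apply: is_derive_sum => i; have gi := g_derive i t.
apply: is_derive_eq; rewrite expr1 /GRing.scale/=; ring.
Qed.

Let sum_continuous (F : 'I_n -> R -> R) : (forall i, continuous (F i)) ->
  continuous (fun t => \sum_(i < n) F i t).
Proof. by move=> Fc; apply: continuous_big => //; exact: add_continuous. Qed.

Let sqr_continuous (f : R -> R) : continuous f -> continuous (fun t => f t ^+ 2).
Proof.
move=> fc t; apply: (@continuous_comp _ _ _ f (fun u => u ^+ 2)).
  exact: fc.
exact: exprn_continuous.
Qed.

Let g_continuous i : continuous (g i).
Proof.
move=> t; apply: differentiable_continuous; apply/derivable1_diffP.
by case: gxy => dg _ _ _ _; exact: dg.
Qed.

Let dg_continuous i : continuous (derive1 (g i)).
Proof. by case: gxy => _ dg _ _ _; exact: dg. Qed.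

Let h_continuous : continuous h.
Proof.
by apply: sum_continuous => i; apply: sqr_continuous; exact: g_continuous.
Qed.

Let dh_continuous : continuous dh.
Proof.
apply: sum_continuous => i t; apply: cvgM; first exact: cvg_cst.
by apply: cvgM; [exact: g_continuous|exact: dg_continuous].
Qed.

Let den_continuous : continuous den.
Proof.
move=> t; apply: cvgD; first exact: cvg_cst.
by apply: cvgM; [exact: cvg_cst|exact: h_continuous].
Qed.

Let speed_continuous t : 0 <= t <= 1 -> {for t, continuous speed}.
Proof.
move=> t01; apply: cvgM; last first.
  by apply: cvgV; [rewrite gt_eqF// den_gt0|exact: den_continuous].
apply: (@continuous_comp _ _ _ (fun t => \sum_(i < n) derive1 (g i) t ^+ 2)).
  by apply: sum_continuous => i; apply: sqr_continuous; exact: dg_continuous.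
exact: sqrt_continuous.
Qed.

Let speed_integrable :
  lebesgue_measure.-integrable `[0%R, 1%R] (EFin \o speed).
Proof.
apply: continuous_compact_integrable; first exact: segment_compact.
apply: continuous_in_subspaceT => t; rewrite inE/= in_itv/=; exact: speed_continuous.
Qed.

Let speed_ge0 t : 0 <= t <= 1 -> 0 <= speed t.
Proof. by move=> t01; rewrite divr_ge0 ?sqrtr_ge0// ltW// den_gt0. Qed.

Let sf_lengthE : sf_length K g = (\int[lebesgue_measure]_(t in `[0%R, 1%R]) (speed t)%:E)%E.
Proof. by apply: eq_integral => t _; rewrite curve_denomE. Qed.

Lemma sf_length_ge0 : (0 <= sf_length K g)%E.
Proof.
rewrite sf_lengthE; apply: integral_ge0 => t /=; rewrite in_itv/= => t01.
by rewrite lee_fin speed_ge0.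
Qed.

Lemma sf_length_lty : (sf_length K g < +oo)%E.
Proof.
rewrite sf_lengthE; have := integrable_fin_num _ speed_integrable.
by rewrite fin_numElt => /(_ _)/andP[].
Qed.

(** The function [ln (|g|^2 + s^2) - ln (1 + K/4 |g|^2)] grows along the curve at
    most at the rate [(1 - K/4 s^2) / s] times the conformal speed, because
    [2 |g| s <= |g|^2 + s^2]. It plays the role of the distance to the origin at
    scale [s]; unlike the latter it is smooth at the origin, and its formula is
    the same for all signs of [K]. *)
Lemma sf_length_ln_growth s : 0 < s -> 0 < 1 - K / 4 * s ^+ 2 ->
  ((ln ((\sum_(i < n) tnth y i ^+ 2 + s ^+ 2) / sf_denom K y) -
    ln ((\sum_(i < n) tnth x i ^+ 2 + s ^+ 2) / sf_denom K x))%:E <=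
    ((1 - K / 4 * s ^+ 2) / s)%:E * sf_length K g)%E.
Proof.
move=> s0 Ks; set c := 1 - K / 4 * s ^+ 2 in Ks *.
have h0 t : 0 <= h t by apply: sumr_ge0 => i _; exact: sqr_ge0.
have hs0 t : 0 < h t + s ^+ 2 by rewrite ltr_wpDl// exprn_gt0.
pose G t := ln (h t + s ^+ 2) - ln (den t).
pose dG t := dh t * c / ((h t + s ^+ 2) * den t).
have G_derive t : 0 <= t <= 1 -> is_derive t 1 G (dG t).
  move=> t01; have ht := h_derive t; have dt := den_gt0 t01.
  have hs_derive : is_derive t 1 (fun t => h t + s ^+ 2) (dh t).
    by rewrite -[dh t]addr0; apply: is_deriveD.
  have den_derive : is_derive t 1 den (K / 4 * dh t).
    have Kh : is_derive t 1 ((K / 4) \*: h) ((K / 4) *: dh t) by exact: is_deriveZ.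
    have := is_deriveD (is_derive_cst (1 : R) t 1) Kh.
    by rewrite add0r.
  have lnhs := @is_derive1_comp _ (@ln R) (fun t => h t + s ^+ 2) t _ _
    (is_derive1_ln (hs0 t)) hs_derive.
  have lnden := @is_derive1_comp _ (@ln R) den t _ _ (is_derive1_ln dt) den_derive.
  have -> : dG t = (h t + s ^+ 2)^-1 * dh t - (den t)^-1 * (K / 4 * dh t).
    rewrite /dG; have -> : c = den t - K / 4 * (h t + s ^+ 2) by rewrite /c /den; ring.
    by field; rewrite !gt_eqF.
  exact: (is_deriveB lnhs lnden).
have G_continuous t : 0 <= t <= 1 -> {for t, continuous G}.
  move=> t01; apply: differentiable_continuous; apply/derivable1_diffP.
  exact: (@ex_derive _ _ _ _ _ _ _ (G_derive t t01)).
have dG_continuous t : 0 <= t <= 1 -> {for t, continuous dG}.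
  move=> t01; apply: cvgM.
    by apply: cvgM; [exact: dh_continuous|exact: cvg_cst].
  apply: cvgV; first by rewrite gt_eqF// mulr_gt0// den_gt0.
  apply: cvgM; last exact: den_continuous.
  by apply: cvgD; [exact: h_continuous|exact: cvg_cst].
have dG_within : {within `[0, 1], continuous dG}.
  apply: continuous_in_subspaceT => t; rewrite inE/= in_itv/=; exact: dG_continuous.
have FTC : (\int[lebesgue_measure]_(t in `[0%R, 1%R]) (dG t)%:E = (G 1)%:E - (G 0)%:E)%E.
  apply: continuous_FTC2 => //.
    split=> [t|  |].
    - rewrite in_itv/= => /andP[t0 t1].
      by have /G_derive[] : 0 <= t <= 1 by rewrite !ltW.
    - by apply: cvg_at_right_filter; apply: G_continuous; rewrite lexx ler01.
    - by apply: cvg_at_left_filter; apply: G_continuous; rewrite lexx ler01.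
  move=> t; rewrite in_itv/= => /andP[t0 t1].
  have /G_derive dGt : 0 <= t <= 1 by rewrite !ltW.
  by rewrite derive1E; exact: derive_val.
have endpoint t z : 0 <= t <= 1 -> sf_point g t = z ->
    ln ((\sum_(i < n) tnth z i ^+ 2 + s ^+ 2) / sf_denom K z) = G t.
  move=> t01 <-; rewrite curve_denomE lnM ?posrE ?invr_gt0 ?den_gt0//.
    rewrite lnV ?posrE ?den_gt0//.
    by congr (ln (_ + _) - _); apply: eq_bigr => i _; rewrite tnth_mktuple.
  rewrite (eq_bigr (fun i => g i t ^+ 2)); first exact: hs0.
  by move=> i _; rewrite tnth_mktuple.
case: gxy => _ _ _ gx gy.
rewrite (endpoint _ _ _ gy) ?lexx ?ler01// (endpoint _ _ _ gx) ?lexx ?ler01//.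
rewrite EFinB -FTC sf_lengthE -integralZl//.
apply: le_integral => //.
- by apply: continuous_compact_integrable => //; exact: segment_compact.
- exact: integrableZl speed_integrable.
move=> t; rewrite inE/= in_itv/= => t01; rewrite -EFinM lee_fin.
have dt := den_gt0 t01; set v := Num.sqrt (\sum_(i < n) derive1 (g i) t ^+ 2).
have dh_le : dh t * s <= (h t + s ^+ 2) * v.
  have dh_le : dh t <= 2 * (Num.sqrt (h t) * v).
    by rewrite /dh -mulr_sumr ler_pM2l//; exact: sum_mul_le.
  have := sqr_ge0 (Num.sqrt (h t) - s); have := sqr_sqrtr (h0 t).
  have v0 : 0 <= v by exact: sqrtr_ge0.
  nra.
rewrite /dG /speed -/v -subr_ge0.
have -> : c / s * (v / den t) - dh t * c / ((h t + s ^+ 2) * den t) =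
    c / (s * den t * (h t + s ^+ 2)) * ((h t + s ^+ 2) * v - dh t * s).
  by field; rewrite !gt_eqF.
by rewrite mulr_ge0 ?subr_ge0// divr_ge0 ?(ltW Ks)// !mulr_ge0// ltW.
Qed.

End conformal_curves.

Section small_space_form_balls.
Context {R : realType}.
Implicit Types (K s : R) (n : nat).

(** Radial segments stay in the domain, so the distance to the origin is a
    genuine infimum of lengths and not the default value of [fine]. *)
Lemma sf_curve_segment K n (y : n.-tuple R) : sf_domain K y ->
  sf_curve K (sf_origin n) y (fun i t => t * tnth y i).
Proof.
move=> Ky; split.
- by move=> i t.
- move=> i; rewrite (_ : derive1 _ = cst (tnth y i)); first exact: cst_continuous.
  apply/funext => t; rewrite derive1E; apply: derive_val.
  by apply: is_derive_eq; rewrite scaler0 add0r /GRing.scale/= mulr1.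
- move=> t /andP[t0 t1]; move: Ky; rewrite /sf_domain /sf_denom/=.
  under [X in _ -> 0 < 1 + _ * X]eq_bigr do rewrite tnth_mktuple exprMn.
  rewrite -mulr_sumr; set q := \sum_(i < n) _.
  have t2 : 0 <= t ^+ 2 <= 1 by rewrite sqr_ge0 expr_le1.
  rewrite mulrCA; set u := K / 4 * q => u1; move: t2 => /andP[].
  set w := t ^+ 2 => w0 w1.
  by have [u0|u0] := ltP u 0; nra.
- by apply: eq_from_tnth => i; rewrite !tnth_mktuple mul0r.
- by apply: eq_from_tnth => i; rewrite !tnth_mktuple mul1r.
Qed.

Lemma sf_dist_lt_curve K n (y : n.-tuple R) s : sf_domain K y ->
  sf_dist K (sf_origin n) y < s ->
  exists2 g, sf_curve K (sf_origin n) y g & (sf_length K g < s%:E)%E.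
Proof.
move=> Ky; rewrite /sf_dist; set S := [set _ | _ in _] => ds.
have S_fin : ereal_inf S \is a fin_num.
  rewrite ge0_fin_numE.
    apply: le_lt_trans (sf_length_lty (sf_curve_segment Ky)).
    apply: ereal_inf_lbound; exists (fun i t => t * tnth y i) => //.
    exact: sf_curve_segment.
  by apply: le_ereal_inf_tmp => _ [g gy <-]; exact: sf_length_ge0 gy.
have : (ereal_inf S < s%:E)%E by rewrite -(fineK S_fin) lte_fin.
by move=> /ereal_inf_lt[_ [g gy <-] gs]; exists g.
Qed.

(** A curve of length less than [s] makes the logarithm in
    [sf_length_ln_growth] increase by less than [1 - K/4 s^2], hence by at most
    [2] for small [s]; with [E = exp 2] this reads
    [|y|^2 + s^2 <= E s^2 (1 + K/4 |y|^2)], which bounds [|y|] by a multiple of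
    [s] once [E |K/4| s^2 <= 1/2]. *)
Lemma sf_small_ball_bounds K n : exists2 L : R, 0 < L & exists2 s0 : R, 0 < s0 &
  forall s (y : n.-tuple R), 0 < s < s0 -> sf_domain K y ->
    sf_dist K (sf_origin n) y < s ->
    \sum_(i < n) tnth y i ^+ 2 <= (L * s) ^+ 2 /\ 2^-1 <= sf_denom K y.
Proof.
pose E : R := expR 2.
have E1 : 1 <= E by rewrite /E -expR0 ler_expR.
have E0 : 0 < E by rewrite expR_gt0.
exists (2 * E); first by rewrite mulr_gt0.
(* The radius 1 / Q makes |K/4| (2 E s)^2 <= 1/2, hence sf_denom >= 1/2. *)
pose k := K / 4; pose Q := 8 * E ^+ 2 * `|k| + 1.
have Q0 : 0 < Q by rewrite ltr_wpDl// mulr_ge0// mulr_ge0// sqr_ge0.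
exists Q^-1; first by rewrite invr_gt0.
move=> s y /andP[s0 sQ] Ky /(sf_dist_lt_curve Ky)[g gy gs].
have Q1 : 1 <= Q by rewrite lerDr mulr_ge0// mulr_ge0// sqr_ge0.
have s1 : s < 1 by rewrite (lt_le_trans sQ)// invf_le1.
have Qs2 : Q * s ^+ 2 <= 1.
  have : Q * s < 1 by rewrite mulrC -ltr_pdivlMr// div1r.
  by have := s1; rewrite expr2; nra.
set h := \sum_(i < n) _.
have h0 : 0 <= h by apply: sumr_ge0 => i _; exact: sqr_ge0.
have s20 : 0 < s ^+ 2 by rewrite exprn_gt0.
have ks : `|k| * s ^+ 2 * (8 * E ^+ 2) <= 1.
  by apply: le_trans Qs2; rewrite /Q mulrDl mul1r; have := ltW s20; nra.
have EE1 : 1 <= E ^+ 2 by rewrite exprn_ege1.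
have EE : E <= E ^+ 2 by rewrite expr2 ler_peMl// ltW.
have ks0 : 0 <= `|k| * s ^+ 2 by rewrite mulr_ge0// ltW.
have [k_ge k_le] : - (`|k| * s ^+ 2) <= k * s ^+ 2 /\ k * s ^+ 2 <= `|k| * s ^+ 2.
  by rewrite -mulNr !ler_pM2r// ler_norm; have := ler_norm (- k); rewrite normrN lerNl.
set c := 1 - k * s ^+ 2.
have c0 : 0 < c by rewrite /c; nra.
have c2 : c <= 2 by rewrite /c; nra.
have Ky0 : 0 < sf_denom K y by [].
have den_y : sf_denom K y = 1 + k * h by [].
have := sf_length_ln_growth gy s0 c0; rewrite -/c -/h.
have -> : \sum_(i < n) tnth (sf_origin n) i ^+ 2 = 0 :> R.
  by rewrite big1// => i _; rewrite tnth_mktuple expr0n.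
have -> : sf_denom K (sf_origin n) = 1.
  by rewrite /sf_denom big1 ?mulr0 ?addr0// => i _; rewrite tnth_mktuple expr0n.
rewrite add0r divr1.
have len_fin : sf_length K g \is a fin_num.
  by rewrite ge0_fin_numE ?(sf_length_lty gy)//; exact: sf_length_ge0 gy.
move: gs; rewrite -(fineK len_fin) -EFinM lte_fin lee_fin => gs growth.
have {}growth : ln ((h + s ^+ 2) / sf_denom K y) <= 2 + ln (s ^+ 2).
  rewrite -lerBlDr (le_trans growth)// (le_trans _ c2)//.
  by rewrite mulrAC ler_pdivrMr// ler_pM2l// ltW.
have {}growth : h + s ^+ 2 <= E * s ^+ 2 * (1 + k * h).
  rewrite -den_y -ler_pdivrMr// -[leLHS]lnK; last first.
    by rewrite posrE divr_gt0// ltr_wpDl.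
  by rewrite (le_trans (_ : _ <= expR (2 + ln (s ^+ 2))))// ?ler_expR// expRD lnK.
have Ek : E * (k * s ^+ 2) <= 1 / 2 by nra.
have h_le : h <= (2 * E * s) ^+ 2 by rewrite !exprMn; nra.
split=> //; rewrite den_y.
have kh : - (`|k| * h) <= k * h.
  by rewrite -mulNr ler_wpM2r// lerNl -normrN ler_norm.
have : `|k| * h <= `|k| * (2 * E * s) ^+ 2 by rewrite ler_wpM2l.
rewrite !exprMn; nra.
Qed.

Lemma measurable_tuple_box n (a : R) :
  measurable [set x : n.-tuple R | forall i, tnth x i \in `[- a, a]].
Proof.
rewrite (_ : [set _ | _] = \bigcap_(i in [set: 'I_n])
    ((fun x : n.-tuple R => tnth x i) @^-1` `[- a, a]%classic)).
  apply: fin_bigcap_measurable => [|i _]; first exact: finite_finset.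
  by rewrite -[X in measurable X]setTI; exact: measurable_tnth.
by apply/seteqP; split=> x h i; [move=> _; exact: h|exact: h i I].
Qed.

Lemma lebesgue_tuple_box n (a : R) : 0 <= a ->
  lebesgue_tuple n [set x : n.-tuple R | forall i, tnth x i \in `[- a, a]] =
  ((2 * a) ^+ n)%:E.
Proof.
move=> a0.
have leb : lebesgue_measure `[- a, a]%classic = (2 * a)%:E.
  rewrite lebesgue_measure_itv/= lte_fin; have [a_gt0|a_le0] := ltP (- a) a.
    by rewrite -EFinB opprK; congr _%:E; ring.
  have -> : a = 0 by lra.
  by rewrite mulr0.
elim: n => [|n IHn].
  by rewrite /= diracE mem_set ?expr0// => -[].
rewrite /= /pushforward_measure /pushforward.
rewrite (_ : _ @^-1` _ =
    [set x : n.-tuple R | forall i, tnth x i \in `[- a, a]] `*` `[- a, a]%classic).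
  rewrite exprSr EFinM -IHn -leb; apply: product_measure1E => //.
  exact: measurable_tuple_box.
apply/seteqP; split=> [[x u] /= h|[x u] /= [xa ua] i].
  split; last by have := h ord0; rewrite tnth0.
  by move=> i; have := h (lift ord0 i); rewrite tnthS.
by have [j ->|->] := unliftP ord0 i; rewrite ?tnthS ?tnth0.
Qed.

(** Monotonicity over arbitrary sets: the integral of a nonnegative function is a
    supremum over the simple functions below it. It serves to compare the metric
    balls of the space form with Euclidean boxes. *)
Lemma ge0_le_integral_subset d (T : measurableType d)
    (mu : {measure set T -> \bar R}) (A B : set T) (f1 f2 : T -> \bar R) :
  (forall x, A x -> (0 <= f1 x)%E) -> (forall x, B x -> (0 <= f2 x)%E) ->
  (forall x, A x -> B x /\ (f1 x <= f2 x)%E) ->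
  (\int[mu]_(x in A) f1 x <= \int[mu]_(x in B) f2 x)%E.
Proof.
move=> f10 f20 f12; rewrite !ge0_integralE//; apply: ereal_sup_le.
move=> _ [g gf <-]; exists g => // x; apply: le_trans (gf x) _.
rewrite !patchE; case: ifPn => [/set_mem/f12[Bx]|_]; first by rewrite mem_set.
by case: ifPn => // /set_mem; exact: f20.
Qed.

(** The ball of radius [s] is contained in a box of side of order [s], on which
    the Riemannian volume density is at most [2 ^ n]. *)
Lemma sf_ball_volume_le K n : exists2 C : R, 0 < C & exists2 s0 : R, 0 < s0 &
  forall s, 0 < s < s0 -> (sf_ball_volume K n s <= (C * s ^+ n)%:E)%E.
Proof.
have [L L0 [s0 s00 ball_le]] := sf_small_ball_bounds K n.
pose V := `|(fine (sf_cone_mass K n))^-1|.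
exists ((V + 1) * (2 ^+ n * (2 * L) ^+ n)).
  apply: mulr_gt0; first exact: ltr_wpDl (normr_ge0 _) ltr01.
  by rewrite mulr_gt0// exprn_gt0// mulr_gt0.
exists s0 => // s ss0; have s_gt0 : 0 < s by case/andP: ss0.
have Ls0 : 0 <= L * s by rewrite mulr_ge0// ltW.
rewrite /sf_ball_volume; set I := sf_integral _ _ _.
have den_gt0 (x : n.-tuple R) : sf_domain K x -> 0 < sf_denom K x by [].
have I0 : (0 <= I)%E.
  apply: integral_ge0 => x [/den_gt0 Kx _].
  by rewrite lee_fin /= div1r invr_ge0 exprn_ge0// ltW.
have I_le : (I <= (2 ^+ n * (2 * (L * s)) ^+ n)%:E)%E.
  rewrite EFinM -(lebesgue_tuple_box _ Ls0) -integral_cst; last exact: measurable_tuple_box.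
  apply: ge0_le_integral_subset => /= x.
  - move=> [/den_gt0 Kx _].
    by rewrite lee_fin div1r invr_ge0 exprn_ge0// ltW.
  - by rewrite lee_fin exprn_ge0.
  move=> [Kx /(ball_le _ _ ss0 Kx)[h_le den_ge]]; split.
    move=> i; rewrite in_itv/= -ler_norml -(@ler_pXn2r _ 2) ?nnegrE//.
    rewrite real_normK ?num_real// (le_trans _ h_le)// (bigD1 i)//= lerDl.
    by apply: sumr_ge0 => j _; exact: sqr_ge0.
  have Kx0 := den_gt0 _ Kx.
  by rewrite lee_fin div1r -exprVn lerXn2r ?nnegrE ?invr_ge0 ?(ltW Kx0)// invf_ple ?posrE.
have -> : (V + 1) * (2 ^+ n * (2 * L) ^+ n) * s ^+ n = (V + 1) * (2 ^+ n * (2 * (L * s)) ^+ n).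
  by rewrite !exprMn; ring.
rewrite EFinM; apply: (@le_trans _ _ ((V + 1)%:E * I)%E).
  by rewrite lee_wpmul2r// lee_fin (le_trans (ler_norm _))// lerDl.
by rewrite lee_wpmul2l// lee_fin addr_ge0// normr_ge0.
Qed.

End small_space_form_balls.

(** * Volume bound from the Bishop inequality *)

(** The normalizing factor of the rescaled measure at a small scale is the
    inverse of a positive real number, and not the default value of an infinite
    mass. *)
Lemma cone_mass_bounds (R : realType) (X : pmetricType R)
    (m : {measure set (borel X) -> \bar R}) (x : X) (r : R) : 0 < r ->
  supp m x -> (m (ball x r) < +oo)%E ->
  (0 < cone_mass m (fun y : borel X => (mdist x (y : X) / r)%R) < +oo)%E.
Proof.
move=> r0 mx mr; rewrite /cone_mass.
have ballE s : [set y : borel X | mdist x (y : X) / r < s] = ball x (s * r).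
  by rewrite ballEmdist; apply/seteqP; split=> y /=; rewrite ltr_pdivrMr.
have mball s : measurable (ball x s : set (borel X)) by exact: measurable_metric_ball.
have mcone : measurable_fun setT (fun y : borel X => (1 - mdist x (y : X) / r)%:E).
  apply/measurable_EFinP/measurable_funB => //.
  by apply: measurable_funM => //; exact: measurable_mdist.
have cone_ge0 y : ball x (1 * r) y -> (0 <= (1 - mdist x y / r)%:E :> \bar R)%E.
  by rewrite ballEmdist/= => yr; rewrite lee_fin subr_ge0 ler_pdivrMr// ltW.
rewrite ballE; apply/andP; split.
  apply: (@lt_le_trans _ _ (\int[m]_(y in ball x (2^-1 * r)) (cst (2^-1)%:E y))%E).
    by rewrite integral_cst// mule_gt0// ?lte_fin ?invr_gt0// mx// mulr_gt0// invr_gt0.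
  apply: (@le_trans _ _ (\int[m]_(y in ball x (2^-1 * r)) (1 - mdist x (y : X) / r)%:E)%E).
    apply: ge0_le_integral => //.
    - by move=> y _; rewrite lee_fin.
    - exact: measurable_funTS.
    - by move=> y; rewrite ballEmdist/= -ltr_pdivrMr// => yr; rewrite lee_fin; lra.
  apply: ge0_subset_integral => //; first exact: measurable_funTS.
  by apply: le_ball; rewrite ler_pM2r//; lra.
apply: (@le_lt_trans _ _ (\int[m]_(y in ball x (1 * r)) (cst 1 y))%E).
  apply: ge0_le_integral => //; first exact: measurable_funTS.
  by move=> y _; rewrite lee_fin gerBl divr_ge0 ?mdist_ge0// ltW.
by rewrite integral_cst// mul1e mul1r.
Qed.

(** A single scale [r] is fixed: as [s] tends to [0] the Bishop inequality at that
    scale already bounds the volume of all small balls by a multiple of the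
    volume of small balls in a fixed space form. *)
Lemma ball_density_upper (R : realType) (K : R) (N : nat) (X : pmetricType R)
    (m : {measure set (borel X) -> \bar R}) (x : X) :
  locally_finite m -> (0 < diam X)%E -> supp m x -> bishop_inequality K N m ->
  (limf_esup (ball_density N m x) 0^'+ < +oo)%E.
Proof.
move=> fin diam0 mx bishop.
have [r1 r10 mr1] := fin x.
have [r0 r00 bi] := bishop 1 x ltr01.
pose r := Num.min r0 r1 / 2.
have r_gt0 : 0 < r by rewrite divr_gt0// lt_min r00.
have [rr0 rr1] : r < r0 /\ r < r1.
  have := r_gt0; rewrite /r => ?; split.
    by have : Num.min r0 r1 <= r0; [rewrite ge_min lexx|lra].
  by have : Num.min r0 r1 <= r1; [rewrite ge_min lexx orbT|lra].
have mr : (m (ball x r) < +oo)%E.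
  by apply: le_lt_trans mr1; exact/le_measure_ball/ltW.
have /andP[cm0 cmoo] := cone_mass_bounds r_gt0 mx mr.
set cm := cone_mass _ _ in cm0 cmoo.
have [C C0 [s0 s00 volume_le]] := sf_ball_volume_le (r ^+ 2 * K) N.
have [d d0 d_diam] : exists2 d : R, 0 < d & (d%:E < Order.min (diam X) 1)%E.
  have : (0 < Order.min (diam X) 1)%E by rewrite lt_min diam0 lte_fin ltr01.
  have : (Order.min (diam X) 1 <= 1)%E by rewrite ge_min lexx orbT.
  case: (Order.min _ _) => [u _ u0|//|//]; exists (u / 2).
    by rewrite divr_gt0// -lte_fin.
  by move: u0; rewrite !lte_fin; lra.
apply: (@le_lt_trans _ _ (((fine cm) * (2 * C) / r ^+ N)%:E)); last exact: ltry.
apply: limf_esup_le_near; near=> t.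
have t0 : 0 < t by [].
have t_s0 : t < s0 * r by near: t; apply: nbhs_right_lt; rewrite mulr_gt0.
have t_d : t < d * r by near: t; apply: nbhs_right_lt; rewrite mulr_gt0.
have tr0 : 0 < t / r by rewrite divr_gt0.
have := bi r (t / r); rewrite r_gt0 rr0 => /(_ isT tr0).
have -> : ((t / r)%:E < Order.min (diam X) 1)%E.
  by rewrite (lt_trans _ d_diam)// lte_fin ltr_pdivrMr.
move=> /(_ isT); rewrite /rescaled_measure /normalize_at /= /mscale /=.
rewrite (_ : [set y | _] = ball x t); last first.
  by rewrite ballEmdist; apply/seteqP; split=> y /=; rewrite ltr_pM2r// invr_gt0.
rewrite -/cm => bi_t.
have {}bi_t : (((fine cm)^-1)%:E * m (ball x t) <= (2 * (C * (t / r) ^+ N))%:E)%E.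
  apply: le_trans bi_t _; rewrite [leRHS]EFinM lee_wpmul2l//.
  by apply: volume_le; rewrite tr0 ltr_pdivrMr.
have mt_fin : m (ball x t) \is a fin_num.
  rewrite ge0_fin_numE//; apply: le_lt_trans mr.
  apply: le_measure_ball; rewrite (le_trans (ltW t_d))// ger_pMl//.
  by rewrite -lee_fin ltW// (lt_le_trans d_diam)// ge_min lexx orbT.
rewrite /ball_density -(fineK mt_fin) -EFinM lee_fin.
move: bi_t; rewrite -(fineK mt_fin) -EFinM lee_fin.
rewrite ler_pdivrMl ?fine_gt0 ?cm0// => bi_t.
rewrite ler_pdivrMr ?exprn_gt0// (le_trans bi_t)//.
rewrite expr_div_n le_eqVlt; apply/orP; left; apply/eqP; field.
by rewrite expf_neq0// gt_eqF.
Unshelve. all: by end_near.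
Qed.

Theorem corollary4p5 (R : realType) (K : R) (N : nat) (X : pmetricType R)
    (m : {measure set (borel X) -> \bar R}) :
  (1 < N)%N ->
  metric_measure_space m ->
  nontrivial m ->
  RCDstar K N%:R m ->
  supp m = [set: X] ->
  bishop_inequality K N m ->
  (forall x : X,
    [/\ (0 < limf_einf (ball_density N m x) 0^'+)%E,
        (limf_einf (ball_density N m x) 0^'+ <=
          limf_esup (ball_density N m x) 0^'+)%E
      & (limf_esup (ball_density N m x) 0^'+ < +oo)%E]) /\
  (forall x : X, regular_set m N x ->
    [/\ (0 < limf_einf (ball_density N m x) 0^'+)%E,
        (limf_einf (ball_density N m x) 0^'+ <=
          limf_esup (ball_density N m x) 0^'+)%E
      & (limf_esup (ball_density N m x) 0^'+ < +oo)%E]).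
Proof.
move=> N1 [_ sepX fin _] [diam0 _] [cde _] suppX bishop.
have density x : [/\ (0 < limf_einf (ball_density N m x) 0^'+)%E,
    (limf_einf (ball_density N m x) 0^'+ <=
      limf_esup (ball_density N m x) 0^'+)%E
  & (limf_esup (ball_density N m x) 0^'+ < +oo)%E].
  have mx : supp m x by rewrite suppX.
  split; [|exact: limf_einf_le_esup|exact: (ball_density_upper fin diam0 mx bishop)].
  by apply: (ball_density_lower _ sepX fin mx cde); exact: ltnW.
by split=> x *; exact: density.
Qed.
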